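(* Let $2<p<+\infty$. For every fixed $w_2\in\mathbb{D}$, the operator $\mathcal{B}^+_{\mathbb{D}}: L^p(\mathbb{D},|w_1-w_2|^2)\to L^p(\mathbb{D},|w_1-w_2|^2)$ is bounded, where $|w_1-w_2|^2$ is regarded as a weight function of $w_1\in\mathbb{D}$. Moreover, its norm is bounded by a constant independent of $w_2\in\mathbb{D}$.
   Context: $\mathbb{D}$ is the open unit disk in $\mathbb{C}$. For a weight $\sigma>0$ on $\mathbb{D}$, $L^p(\mathbb{D},\sigma)$ has norm $\left(\int_{\mathbb{D}}|f|^p\sigma\,dA\right)^{1/p}$, where $dA$ is Lebesgue area measure. The Bergman kernel of $\mathbb{D}$ is $B(w,\eta)=\frac{1}{\pi(1-w\bar\eta)^2}$, and $\mathcal{B}^+_{\mathbb{D}}$ is the operator $$\mathcal{B}^+_{\mathbb{D}}(f)(w)=\int_{\mathbb{D}}|B(w,\eta)|\,f(\eta)\,dA(\eta).$$ *)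

(* Defs.v *)
From HB Require Import structures.
From mathcomp Require Import all_boot all_order all_algebra.
From mathcomp Require Import complex.
From mathcomp Require Import all_classical all_reals all_analysis.

Set Implicit Arguments.
Unset Strict Implicit.
Unset Printing Implicit Defensive.

Import Order.TTheory GRing.Theory Num.Theory.
Import numFieldNormedType.Exports.

Local Open Scope classical_set_scope.
Local Open Scope ring_scope.
Local Open Scope complex_scope.

(* R[i] carries no measurable structure in the libraries: functions of a
   complex variable are integrated over the plane through to_complex.
   measurableTypeR R is R with the display carried by lebesgue_measure. *)
Notation plane R := (measurableTypeR R * measurableTypeR R)%type.

Definition to_complex (R : realType) (z : plane R) : R[i] := z.1 +i* z.2.

Definition cabs (R : realType) (w : R[i]) : R := ComplexField.Normc.normc w.

Definition disk (R : realType) : set R[i] := [set w | cabs w < 1].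

Definition plane_disk (R : realType) : set (plane R) :=
  @to_complex R @^-1` @disk R.

Definition area (R : realType) : {measure set (plane R) -> \bar R} :=
  (@lebesgue_measure R \x @lebesgue_measure R)%E.

Definition disk_measurable (R : realType) (F : R[i] -> R[i]) : Prop :=
  measurable_fun (@plane_disk R) (fun z => complex.Re (F (to_complex z))) /\
  measurable_fun (@plane_disk R) (fun z => complex.Im (F (to_complex z))).

Definition disk_integrable (R : realType) (F : R[i] -> R[i]) : Prop :=
  (area R).-integrable (@plane_disk R)
    (fun z => (complex.Re (F (to_complex z)))%:E) /\
  (area R).-integrable (@plane_disk R)
    (fun z => (complex.Im (F (to_complex z)))%:E).

(* Equal to the junk value of the real integral when F is not integrable. *)
Definition disk_integral (R : realType) (F : R[i] -> R[i]) : R[i] :=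
  (\int[area R]_(z in @plane_disk R) complex.Re (F (to_complex z)))%R +i*
  (\int[area R]_(z in @plane_disk R) complex.Im (F (to_complex z)))%R.

Definition disk_ae_eq (R : realType) (F G : R[i] -> R[i]) : Prop :=
  {ae area R, forall z, plane_disk z -> F (to_complex z) = G (to_complex z)}.

Definition Lp_norm (R : realType) (p : R) (sigma : R[i] -> R)
    (f : R[i] -> R[i]) : \bar R :=
  ((\int[area R]_(z in @plane_disk R)
      (cabs (f (to_complex z)) `^ p * sigma (to_complex z))%:E) `^ p^-1)%E.

(* Representatives of the elements of L^p(D, sigma). *)
Definition in_Lp (R : realType) (p : R) (sigma : R[i] -> R)
    (f : R[i] -> R[i]) : Prop :=
  disk_measurable f /\ (Lp_norm p sigma f < +oo)%E.

(* The first clause says that T descends to classes modulo a.e. equality. *)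
Definition bounded_operator (R : realType) (p : R) (sigma : R[i] -> R)
    (T : (R[i] -> R[i]) -> R[i] -> R[i]) : Prop :=
  [/\ forall f g, in_Lp p sigma f -> in_Lp p sigma g ->
        disk_ae_eq f g -> disk_ae_eq (T f) (T g),
      forall (a : R[i]) f g, in_Lp p sigma f -> in_Lp p sigma g ->
        disk_ae_eq (T (fun w => a * f w + g w)) (fun w => a * T f w + T g w),
      forall f, in_Lp p sigma f -> in_Lp p sigma (T f)
    & exists C : R, forall f, in_Lp p sigma f ->
        (Lp_norm p sigma (T f) <= C%:E * Lp_norm p sigma f)%E].

Definition operator_norm (R : realType) (p : R) (sigma : R[i] -> R)
    (T : (R[i] -> R[i]) -> R[i] -> R[i]) : \bar R :=
  ereal_sup [set Lp_norm p sigma (T f) |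
             f in [set f | in_Lp p sigma f /\ (Lp_norm p sigma f <= 1)%E]].

Definition bergman_kernel (R : realType) (w eta : R[i]) : R[i] :=
  1 / ((pi : R)%:C * (1 - w * eta^*) ^+ 2).

Definition bergman_plus_integrand (R : realType) (f : R[i] -> R[i])
    (w eta : R[i]) : R[i] :=
  (cabs (bergman_kernel w eta))%:C * f eta.

Definition bergman_plus (R : realType) (f : R[i] -> R[i]) (w : R[i]) : R[i] :=
  disk_integral (bergman_plus_integrand f w).

Definition sq_dist_weight (R : realType) (w2 w1 : R[i]) : R :=
  cabs (w1 - w2) ^+ 2.

(* Main.v *)
(** Fix [p > 2] and a point [a], and put [g := |f| |. - a|^(2/p)], so that the weighted norm
    of [f] is the plain [L^p] norm of [g].  Subadditivity of [t^(2/p)] gives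
      [|w - a|^(2/p) <= 2 (|w - z|^(2/p) + |z - a|^(2/p))],
    and [|w - z| <= |1 - w conj z|] on the disk, so [|w - a|^(2/p) B^+ f(w)] is at most a
    constant times the integral of [g] against
      [|1 - w conj z|^(-2)]   and   [|w - z|^(-2 + 2/p) |z - a|^(-2/p)].
    Both operators are bounded on [L^p] of the plane by Schur's test, uniformly in [a].
    For the first the test function is [(1 - |z|^2)^(-1/p)], which rests on a Forelli-Rudin
    estimate.  The second, a Stein-Weiss operator, is dominated almost everywhere by a tensor
    product of one-dimensional kernels since [|z|^2 >= |Re z| |Im z|]; its test function is
    [(|Re (z - a)| |Im (z - a)|)^(-1/p)], and this is where [p > 2] is needed.
    All one-dimensional integrals reduce to
      [\int |t|^(-A) (r + |t|)^(-B) dt <= C r^(1 - A - B)],  [0 <= A < 1 < A + B],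
    which is a dyadic sum. *)
From HB Require Import structures.
Require Import Defs.
From mathcomp Require Import all_boot all_order all_algebra.
From mathcomp Require Import complex.
From mathcomp Require Import all_classical all_reals all_analysis measurable_realfun.
From mathcomp Require Import ring lra.

Set Implicit Arguments.
Unset Strict Implicit.
Unset Printing Implicit Defensive.

Import Order.TTheory GRing.Theory Num.Theory.
Import numFieldNormedType.Exports.

Local Open Scope classical_set_scope.
Local Open Scope ring_scope.

(** * One-dimensional integrals *)

(** Homogeneity makes the constants uniform in [a]. With b = 1/p, each one-dimensional factor |y -
    x|^(b - 1) |y - a|^(-b) of the second kernel has degree -1, so its Schur integrals return the
    test function times a factor that sees neither the position of [a] nor the scale |x - a|. The
    exponents met are 1 - b and 2 b in one variable, 1 - b twice in the other; integrability at [a]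
    asks for 2 b < 1 and integrability at infinity for 2 - 2 b > 1, and both say p > 2. Integration
    over the plane is done in Cartesian coordinates, by Tonelli. This dictates the tensor product,
    and in the Forelli-Rudin estimate the description of the circle by graphs over both axes. Since
    [disk_integral] has a junk value on nonintegrable functions, every [f] of finite weighted norm
    must be shown integrable against the kernel at each point of the disk. This is drawn from the
    weighted estimate itself, which is proved for nonnegative functions with integrals in
    [0, +oo]. *)

Lemma eqW (R : realType) (x y : R) : x = y -> x <= y.
Proof. by move->. Qed.

Lemma geometric_nneseries (R : realType) (a q : R) :
  0 <= a -> 0 <= q -> q < 1 ->
  (\sum_(0 <= n <oo) (a * q ^+ n)%:E = (a / (1 - q))%:E)%E.
Proof.
move=> a0 q0 q1; apply/cvg_lim => //.
rewrite (_ : (fun n => _) = EFin \o series (geometric a q)); last first.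
  by apply/funext => n /=; rewrite sumEFin /series.
apply: cvg_EFin; first exact: nearW.
by apply: cvg_geometric_series; rewrite ger0_norm.
Qed.

(** A staircase of nested intervals, used twice as a majorant of [riesz]: with intervals that halve
    while the heights grow, and with intervals that double while the heights decay. *)
Lemma integral_layers (R : realType) (a m l k c : R) :
  0 <= a -> 0 <= m -> 0 < l -> 0 < k -> m * k < 1 ->
  (\int[@lebesgue_measure R]_t
     \sum_(0 <= n <oo) (a * m ^+ n * \1_(`[c - l * k ^+ n, c + l * k ^+ n]) t)%:E
   = (2 * a * l / (1 - m * k))%:E)%E.
Proof.
move=> a0 m0 l0 k0 mk1.
rewrite integral_nneseries//; last 2 first.
- move=> n; apply/measurable_EFinP; apply: measurable_funM => //.
- by move=> n t _; rewrite lee_fin !mulr_ge0 ?exprn_ge0.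
rewrite -geometric_nneseries ?mulr_ge0 ?(ltW l0) ?(ltW k0)//.
apply: eq_eseriesr => n _.
have lk : 0 < l * k ^+ n by rewrite mulr_gt0// exprn_gt0.
under eq_integral do rewrite EFinM.
rewrite ge0_integralZl_EFin//; last 2 first.
- exact/measurable_EFinP.
- by rewrite mulr_ge0// exprn_ge0.
rewrite integral_indic// setIT.
rewrite [X in (_ * X)%E](_ : _ = (2 * (l * k ^+ n))%:E).
  by rewrite -EFinM; congr EFin; rewrite exprMn; ring.
have := @lebesgue_measure_itv R `[c - l * k ^+ n, c + l * k ^+ n].
rewrite /= lte_fin ltrD2l gt0_cp// -EFinB => ->; congr EFin; ring.
Qed.

(** Up to constants this is [r ^ (- B) * |t| ^ (- A)] for [|t| <= r] and [|t| ^ (- A - B)] beyond,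
    whence the conditions [A < 1] at the origin and [1 < A + B] at infinity. *)
Definition riesz (R : realType) (A B r t : R) : R :=
  `|t| `^ (- A) * (r + `|t|) `^ (- B).

Lemma riesz_ge0 (R : realType) (A B r t : R) : 0 <= riesz A B r t.
Proof. by rewrite mulr_ge0 ?powR_ge0. Qed.

Lemma measurable_riesz (R : realType) (A B r : R) :
  measurable_fun [set: measurableTypeR R] (riesz A B r).
Proof.
apply: measurable_funM.
  exact: (measurableT_comp (measurable_powR _) (@normr_measurable R setT)).
apply: (measurableT_comp (measurable_powR _)).
by apply: measurable_funD => //; exact: normr_measurable.
Qed.

Lemma powRN_le (R : realType) (x y A : R) :
  0 < x -> x <= y -> 0 <= A -> y `^ (- A) <= x `^ (- A).
Proof.
move=> x0 xy A0; have y0 := lt_le_trans x0 xy.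
by rewrite !powRN lef_pV2 ?posrE ?powR_gt0// ge0_ler_powR ?nnegrE// ltW.
Qed.

Lemma nneseries_ge_term (R : realType) (u : nat -> R) n :
  (forall k, 0 <= u k) -> ((u n)%:E <= \sum_(0 <= k <oo) (u k)%:E)%E.
Proof.
move=> u0; apply: le_trans (nneseries_lim_ge n.+1 _); last first.
  by move=> k _ _; rewrite lee_fin.
by rewrite big_nat_recr//= leeDr// sume_ge0// => k _; rewrite lee_fin.
Qed.

Lemma dyadic_below (R : realType) (r t : R) : 0 < t -> t <= r ->
  exists n : nat, r * 2^-1 ^+ n.+1 < t <= r * 2^-1 ^+ n.
Proof.
move=> t0 tr; have r0 := lt_le_trans t0 tr.
have ex : exists n : nat, r * 2^-1 ^+ n < t.
  have /cvgrPdist_lt/(_ (t / r)) : (fun n => (2^-1 : R) ^+ n) @ \oo --> (0 : R).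
    by apply: cvg_expr; rewrite ger0_norm; lra.
  rewrite divr_gt0// => /(_ isT)[N _ /(_ N)/=]; rewrite leqnn => /(_ isT) H.
  exists N; move: H; rewrite sub0r normrN ger0_norm ?exprn_ge0 ?invr_ge0//.
  by rewrite ltr_pdivlMr// mulrC.
(* The least index with [r / 2 ^ n < t] is not 0 because [t <= r]; its predecessor gives the other
   bound. *)
case: (ex_minnP ex) => -[|n] nt nmin; first by move: nt; rewrite expr0; lra.
exists n; rewrite nt leNgt; apply/negP => /nmin; by rewrite ltnn.
Qed.

Lemma dyadic_above (R : realType) (r t : R) : 0 < r -> r < t ->
  exists n : nat, r * 2 ^+ n <= t < r * 2 ^+ n.+1.
Proof.
(* Here [r] and [t] exchange their roles. *)
move=> r0 rt; have [n] := @dyadic_below _ t r r0 (ltW rt).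
rewrite !exprVn => /andP[n1 n2]; exists n.
have p0 k : 0 < (2 : R) ^+ k by rewrite exprn_gt0.
by move: n1 n2; rewrite ltr_pdivrMr// ler_pdivlMr// => -> ->.
Qed.

Lemma exprn_powR (R : realType) (x a : R) n :
  0 <= x -> (x ^+ n) `^ a = (x `^ a) ^+ n.
Proof. by move=> x0; rewrite -!powR_mulrn ?powR_ge0// powRAC. Qed.

(** In the shell, [|t|] is replaced by the inner radius in the singular factor and by 0 in the
    other; the extra [2 ^ A] comes from the index [n.+1] of the inner radius. *)
Lemma le_riesz_near (R : realType) (A B r t : R) (n : nat) :
  0 <= A -> 0 <= B -> 0 < r -> r * 2^-1 ^+ n.+1 < `|t| ->
  riesz A B r t <= 2 `^ A * r `^ (- A - B) * (2 `^ A) ^+ n.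
Proof.
move=> A0 B0 r0 rt.
have q0 : 0 < r * 2^-1 ^+ n.+1 by rewrite mulr_gt0// exprn_gt0// invr_gt0.
apply: (@le_trans _ _ ((r * 2^-1 ^+ n.+1) `^ (- A) * r `^ (- B))).
  by rewrite ler_pM ?powR_ge0 ?powRN_le ?(ltW rt)// lerDl.
rewrite powRM ?(ltW r0) ?exprn_ge0 ?invr_ge0// exprn_powR ?invr_ge0//.
rewrite -[2^-1]powR_inv1// -powRrM mulN1r opprK exprS.
by rewrite powRD ?(gt_eqF r0) ?implybT// eqW//; ring.
Qed.

Lemma le_riesz_far (R : realType) (A B r t : R) (n : nat) :
  0 <= A -> 0 <= B -> 0 < r -> r * 2 ^+ n <= `|t| ->
  riesz A B r t <= r `^ (- A - B) * (2 `^ (- A - B)) ^+ n.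
Proof.
move=> A0 B0 r0 rt.
have q0 : 0 < r * 2 ^+ n by rewrite mulr_gt0// exprn_gt0.
apply: (@le_trans _ _ ((r * 2 ^+ n) `^ (- A) * (r * 2 ^+ n) `^ (- B))).
  by rewrite ler_pM ?powR_ge0 ?powRN_le// (le_trans rt)// lerDr ltW.
rewrite -powRD ?(gt_eqF q0) ?implybT// powRM ?(ltW r0) ?exprn_ge0//.
by rewrite exprn_powR.
Qed.

Lemma ltr_powR_exp (R : realType) (x a b : R) :
  1 < x -> a < b -> x `^ a < x `^ b.
Proof.
move=> x1 ab; have x0 : 0 < x by lra.
by rewrite /powR (gt_eqF x0) ltr_expR ltr_pM2r// ln_gt0.
Qed.

Lemma integral_riesz_le (R : realType) (A B : R) :
  0 <= A -> A < 1 -> 0 <= B -> 1 < A + B ->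
  exists C : R, 0 <= C /\ forall r c : R, 0 < r ->
    (\int[@lebesgue_measure R]_t (riesz A B r (t - c))%:E
     <= (C * r `^ (1 - A - B))%:E)%E.
Proof.
move=> A0 A1 B0 AB.
(* The two ratios of the dyadic sums: the inner one is below 1 because [A < 1], the outer one
   because [1 < A + B]. *)
have mk1 : 2 `^ A * 2^-1 < 1 :> R.
  by rewrite -powR_inv1// -powRD ?pnatr_eq0 ?implybT// -[ltRHS](powRr0 2) ltr_powR_exp ?ltr1n//; lra.
have mk2 : 2 `^ (- A - B) * 2 < 1 :> R.
  rewrite -{2}[2](@powRr1 _ 2)// -powRD ?pnatr_eq0 ?implybT//.
  by rewrite -[ltRHS](powRr0 2) ltr_powR_exp ?ltr1n//; lra.
(* The values of [integral_layers] for [S1] and [S2] below, with the power of [r] taken out; 4 is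
   twice the 2 of the radius [2 * r]. *)
exists (2 * 2 `^ A / (1 - 2 `^ A * 2^-1) + 4 / (1 - 2 `^ (- A - B) * 2)).
split.
  by rewrite addr_ge0// divr_ge0 ?mulr_ge0 ?powR_ge0// subr_ge0 ltW.
move=> r c r0.
pose L (a m l k t : R) := (\sum_(0 <= n <oo)
  (a * m ^+ n * \1_(`[c - l * k ^+ n, c + l * k ^+ n]) t)%:E)%E.
have L0 a m l k t : 0 <= a -> 0 <= m -> (0 <= L a m l k t)%E.
  by move=> a0 m0; apply: nneseries_ge0 => n _ _; rewrite lee_fin !mulr_ge0 ?exprn_ge0.
have mL a m l k : 0 <= a -> 0 <= m -> measurable_fun [set: measurableTypeR R] (L a m l k).
  move=> a0 m0; apply: ge0_emeasurable_sum => n.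
    by move=> t _ _; rewrite lee_fin !mulr_ge0 ?exprn_ge0.
  by move=> _; apply/measurable_EFinP; apply: measurable_funM.
have in_itv_layer t d : `|t - c| <= d -> t \in [set` `[c - d, c + d]].
  by rewrite ler_distl => /andP[? ?]; rewrite inE/= in_itv/=; apply/andP.
have a10 : 0 <= 2 `^ A * r `^ (- A - B) by rewrite mulr_ge0 ?powR_ge0.
pose S1 := L (2 `^ A * r `^ (- A - B)) (2 `^ A) r 2^-1.
(* The radius is [2 * r], since the shell of index [n] reaches up to [r * 2 ^ n.+1]. *)
pose S2 := L (r `^ (- A - B)) (2 `^ (- A - B)) (2 * r) 2.
apply: (@le_trans _ _ (\int[@lebesgue_measure R]_t (S1 t + S2 t))%E).
  apply: ge0_le_integral => //.
  - by move=> t _; rewrite lee_fin riesz_ge0.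
  - apply/measurable_EFinP.
    by apply: (measurableT_comp (measurable_riesz A B r)); exact: measurable_funB.
  - by apply: emeasurable_funD; apply: mL; rewrite ?powR_ge0.
  move=> t _; have [tr|rt] := leP `|t - c| r; last first.
    apply: le_trans (leeDr _ (L0 _ _ _ _ _ _ _)); rewrite ?powR_ge0//.
    have [n /andP[n1 n2]] := dyadic_above r0 rt.
    apply: le_trans (nneseries_ge_term n _) => [|k]; last first.
      by rewrite !mulr_ge0 ?exprn_ge0 ?powR_ge0.
    rewrite lee_fin indicE in_itv_layer ?mulr1 ?le_riesz_far//.
    by rewrite (le_trans (ltW n2))// exprS; apply: eqW; ring.
  apply: le_trans (leeDl _ (L0 _ _ _ _ _ _ _)); rewrite ?powR_ge0//.
  have [t0|t0] := eqVneq `|t - c| 0.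
    apply: le_trans (nneseries_ge_term 0 _) => [|k]; last first.
      by rewrite !mulr_ge0 ?exprn_ge0 ?powR_ge0.
    rewrite lee_fin indicE in_itv_layer ?mulr1 ?expr0 ?mulr1//.
    rewrite /riesz t0 addr0; have [->|A00] := eqVneq A 0.
      by rewrite oppr0 !powRr0 sub0r.
    by rewrite powR0 ?oppr_eq0// mul0r.
  have [|n /andP[n1 n2]] := dyadic_below _ tr; first by rewrite lt_def t0/=.
  apply: le_trans (nneseries_ge_term n _) => [|k]; last first.
    by rewrite !mulr_ge0 ?exprn_ge0 ?powR_ge0.
  by rewrite lee_fin indicE in_itv_layer// mulr1 le_riesz_near.
rewrite ge0_integralD//; last 4 first.
- by move=> t _; rewrite L0 ?powR_ge0.
- by apply: mL; rewrite ?powR_ge0.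
- by move=> t _; rewrite L0 ?powR_ge0.
- by apply: mL; rewrite ?powR_ge0.
rewrite !integral_layers ?powR_ge0 ?mulr_gt0 ?invr_gt0//.
rewrite -EFinD lee_fin; apply: eqW.
rewrite (_ : 1 - A - B = 1 + (- A - B)); last by ring.
rewrite (powRD (r:=1)) ?(gt_eqF r0) ?implybT// powRr1 ?(ltW r0)//.
rewrite !mulrDl !mulrA mulrAC; congr (_ + _); ring.
Qed.

Lemma measurable_powR_normB (R : realType) (a c : R) :
  measurable_fun [set: measurableTypeR R] (fun t : R => `|t - c| `^ a).
Proof.
apply: (measurableT_comp (measurable_powR _)).
by apply: (measurableT_comp (@normr_measurable R setT)); exact: measurable_funB.
Qed.

(* The smaller of the two distances pairs with its sum with [r]. *)
Lemma powR_le_riesz (R : realType) (A B u v r : R) :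
  0 <= A -> 0 <= B -> 0 < r -> 0 <= u -> 0 <= v -> r <= u + v ->
  u `^ (- A) * v `^ (- B) <= 3 `^ B * riesz A B r u + 3 `^ A * riesz B A r v.
Proof.
move=> A0 B0 r0.
wlog uv : A B u v A0 B0 / u <= v => [hw u0 v0 ruv|u0 v0 ruv].
  have [uv|/ltW vu] := leP u v; first exact: hw.
  by rewrite mulrC addrC; apply: hw => //; rewrite addrC.
rewrite -[leLHS]addr0 lerD ?mulr_ge0 ?powR_ge0// /riesz !ger0_norm//.
rewrite mulrCA ler_wpM2l ?powR_ge0//.
(* From [r <= u + v] and [u <= v] follows [r + u <= 3 v]. *)
rewrite -[leRHS](_ : (3^-1 * (r + u)) `^ (- B) = _); last first.
  by rewrite powRM ?invr_ge0 ?addr_ge0 ?(ltW r0)// -[3^-1]powR_inv1// -powRrM mulN1r opprK.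
by apply: powRN_le => //; lra.
Qed.

(** At the scale [r = |x - a|] the triangle inequality gives [r <= |t - x| + |t - a|], so the
    product is dominated by one [riesz] function around each singularity. *)
Lemma integral_powR_powR_le (R : realType) (A B : R) :
  0 <= A -> A < 1 -> 0 <= B -> B < 1 -> 1 < A + B ->
  exists C : R, 0 <= C /\ forall x a : R, x != a ->
    (\int[@lebesgue_measure R]_t (`|t - x| `^ (- A) * `|t - a| `^ (- B))%:E
     <= (C * `|x - a| `^ (1 - A - B))%:E)%E.
Proof.
move=> A0 A1 B0 B1 AB.
have [C [C0 HC]] := integral_riesz_le A0 A1 B0 AB.
have [D [D0 HD]] := integral_riesz_le B0 B1 A0 (eq_rect _ (fun x => 1 < x) AB _ (addrC _ _)).
exists (3 `^ B * C + 3 `^ A * D); split.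
  by rewrite addr_ge0// mulr_ge0 ?powR_ge0.
move=> x a xa; have r0 : 0 < `|x - a| by rewrite normr_gt0 subr_eq0.
have mr A' B' c : measurable_fun [set: measurableTypeR R]
    (fun t => (riesz A' B' `|x - a| (t - c))%:E).
  apply/measurable_EFinP/(measurableT_comp (measurable_riesz A' B' _)).
  exact: measurable_funB.
have r0e A' B' c t : (0 <= (riesz A' B' `|x - a| (t - c))%:E)%E.
  by rewrite lee_fin riesz_ge0.
apply: (@le_trans _ _ (\int[@lebesgue_measure R]_t
   ((3 `^ B)%:E * (riesz A B `|x - a| (t - x))%:E +
    (3 `^ A)%:E * (riesz B A `|x - a| (t - a))%:E)%E)%E).
  apply: ge0_le_integral => //.
  - by apply/measurable_EFinP/measurable_funM; exact: measurable_powR_normB.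
  - by apply: emeasurable_funD; apply: measurable_funeM.
  move=> t _; rewrite -!EFinM -EFinD lee_fin.
  rewrite -[riesz A B _ _]/(_ * _) -[riesz B A _ _]/(_ * _).
  have := @powR_le_riesz _ A B `|t - x| `|t - a| `|x - a| A0 B0 r0.
  rewrite /riesz !normr_id; apply=> //.
  by rewrite (distrC t x) ler_distD.
rewrite ge0_integralD//; last 4 first.
- by move=> t _; rewrite mule_ge0// lee_fin powR_ge0.
- exact: measurable_funeM.
- by move=> t _; rewrite mule_ge0// lee_fin powR_ge0.
- exact: measurable_funeM.
rewrite !ge0_integralZl_EFin ?powR_ge0//.
rewrite mulrDl EFinD -!mulrA !(EFinM (_ `^ _) (_ * _)).
rewrite leeD// lee_pmul2l ?lte_fin ?powR_gt0//; first exact: HC.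
by rewrite addrAC; exact: HD.
Qed.

(** * Schur test *)

Lemma ge0_hoelder d (T : measurableType d) (R : realType)
    (mu : {measure set T -> \bar R}) (f g : T -> R) (p q : R) :
  measurable_fun [set: T] f -> measurable_fun [set: T] g ->
  (forall x, 0 <= f x) -> (forall x, 0 <= g x) ->
  0 < p -> 0 < q -> p^-1 + q^-1 = 1 ->
  (\int[mu]_x (f x * g x)%:E <=
   (\int[mu]_x (f x `^ p)%:E) `^ p^-1 * (\int[mu]_x (g x `^ q)%:E) `^ q^-1)%E.
Proof.
move=> mf mg f0 g0 p0 q0 pq.
have := hoelder mu mf mg p0 q0 pq; rewrite Lnorm1 unlock.
under eq_integral do rewrite /= ger0_norm ?mulr_ge0//.
under [X in (X `^ p^-1)%E]eq_integral do rewrite /= ger0_norm//.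
by under [X in (X `^ q^-1)%E]eq_integral do rewrite /= ger0_norm//.
Qed.

Section schur.
Context d (T : measurableType d) (R : realType).
Variable mu : {sigma_finite_measure set T -> \bar R}.
Variables (p A B : R) (k : T -> T -> R) (phi g : T -> R).
Hypotheses (p1 : 1 < p) (A0 : 0 <= A) (B0 : 0 <= B).
Hypothesis mk : measurable_fun [set: T * T] (fun z => k z.1 z.2).
Hypothesis mphi : measurable_fun [set: T] phi.
Hypothesis mg : measurable_fun [set: T] g.
Hypotheses (k0 : forall x y, 0 <= k x y) (phi0 : forall x, 0 <= phi x).
Hypothesis g0 : forall x, 0 <= g x.
Hypothesis kphi : forall x y, k x y != 0 -> 0 < phi y.
Hypothesis kphiA : forall x,
  (\int[mu]_y (k x y * phi y)%:E <= (A * phi x)%:E)%E.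
Hypothesis kphiB : forall y,
  (\int[mu]_x (k x y * phi x `^ (p - 1))%:E <= (B * phi y `^ (p - 1))%:E)%E.

Let p0 : 0 < p. Proof. exact: lt_trans p1. Qed.

Let p10 : 0 < p - 1. Proof. by rewrite subr_gt0. Qed.

Let mk1 x : measurable_fun [set: T] (k x).
Proof. exact: measurable_fun_pair2 mk. Qed.

Let mpow (f : T -> R) a : measurable_fun [set: T] f ->
  measurable_fun [set: T] (fun x => f x `^ a).
Proof. by move=> mf; exact: (measurableT_comp (measurable_powR _)). Qed.

Let h y := g y `^ p * phi y `^ (1 - p).

Let h0 y : 0 <= h y. Proof. by rewrite mulr_ge0 ?powR_ge0. Qed.

Let mh : measurable_fun [set: T] h.
Proof. by apply: measurable_funM; exact: mpow. Qed.

(** Hoelder for the factors [k^(1/p) g phi^(-1/q)] and [k^(1/q) phi^(1/q)]. Dividing by [phi] is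
    harmless: by [kphi] it is positive wherever [k] does not vanish. Here [phi] is the [q]-th power
    of the classical Schur test function, so the companion condition [kphiB] carries the exponent
    [p / q = p - 1]. *)
Lemma schur_pointwise x :
  ((\int[mu]_y (k x y * g y)%:E) `^ p <=
   \int[mu]_y (k x y * h y)%:E * ((A * phi x) `^ (p - 1))%:E)%E.
Proof.
pose q := p / (p - 1).
have q0 : 0 < q by rewrite divr_gt0.
have pq : p^-1 + q^-1 = 1 by rewrite /q; field; rewrite !gt_eqF.
have pqE : p * q^-1 = p - 1 by rewrite /q; field; rewrite !gt_eqF.
pose F y := k x y `^ p^-1 * g y * phi y `^ (- q^-1).
pose G y := k x y `^ q^-1 * phi y `^ q^-1.
have mF : measurable_fun [set: T] F.
  by apply: measurable_funM; [apply: measurable_funM => //|]; exact: mpow.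
have mG : measurable_fun [set: T] G by apply: measurable_funM; exact: mpow.
have F0 y : 0 <= F y by rewrite !mulr_ge0 ?powR_ge0.
have G0 y : 0 <= G y by rewrite mulr_ge0 ?powR_ge0.
have FG y : F y * G y = k x y * g y.
  have [k00|kn0] := eqVneq (k x y) 0.
    by rewrite /F /G k00 powR0 ?invr_eq0 ?gt_eqF// !mul0r.
  have ph := kphi kn0.
  rewrite (_ : F y * G y = k x y `^ p^-1 * k x y `^ q^-1 * g y *
    (phi y `^ (- q^-1) * phi y `^ q^-1)); last by rewrite /F /G; ring.
  rewrite -powRD ?kn0 ?implybT// pq powRr1//.
  by rewrite -powRD ?(gt_eqF ph) ?implybT// addNr powRr0 mulr1.
have Fp y : F y `^ p = k x y * h y.
  rewrite /F !powRM ?mulr_ge0 ?powR_ge0// -!powRrM mulVf ?gt_eqF// powRr1//.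
  by rewrite (_ : - q^-1 * p = 1 - p) ?mulrA// mulNr mulrC pqE opprB.
have Gq y : G y `^ q = k x y * phi y.
  by rewrite /G !powRM ?powR_ge0// -!powRrM mulVf ?gt_eqF// !powRr1.
have := ge0_hoelder mu mF mG F0 G0 p0 q0 pq.
rewrite (@eq_integral _ _ _ mu setT (fun y => (k x y * g y)%:E) (fun y => (F y * G y)%:E)); last by move=> y _; rewrite FG.
rewrite (@eq_integral _ _ _ mu setT (fun y => (k x y * h y)%:E) (fun y => (F y `^ p)%:E)); last by move=> y _; rewrite Fp.
rewrite (@eq_integral _ _ _ mu setT (fun y => (k x y * phi y)%:E) (fun y => (G y `^ q)%:E)); last by move=> y _; rewrite Gq.
move=> H; have i0 (f : T -> R) : (forall y, 0 <= f y) ->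
    (0 <= \int[mu]_y (f y)%:E)%E.
  by move=> f0; apply: integral_ge0 => y _; rewrite lee_fin.
have kg0 : (0 <= \int[mu]_y (k x y * g y)%:E)%E.
  by apply: i0 => y; rewrite mulr_ge0.
apply: (@le_trans _ _ (((\int[mu]_y (k x y * h y)%:E) `^ p^-1 *
    (\int[mu]_y (k x y * phi y)%:E) `^ q^-1) `^ p)%E).
  by apply: gt0_ler_poweR; rewrite ?(ltW p0)// in_itv/= leey ?mule_ge0 ?poweR_ge0// kg0.
rewrite poweRM ?poweR_ge0// -!poweRrM mulVf ?gt_eqF// poweRe1; last first.
  by apply: i0 => y; rewrite mulr_ge0.
rewrite [q^-1 * p]mulrC pqE lee_wpmul2l//; first by apply: i0 => y; rewrite mulr_ge0.
rewrite -poweR_EFin; apply: gt0_ler_poweR; rewrite ?(ltW p10)// in_itv/= leey ?andbT.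
- by apply: i0 => y; rewrite mulr_ge0.
- by rewrite lee_fin mulr_ge0.
Qed.

(** After integrating the pointwise bound in [x], Tonelli exposes the integral of [kphiB]; the
    powers [1 - p] and [p - 1] of [phi] then cancel. *)
Lemma schur_test :
  (\int[mu]_x (\int[mu]_y (k x y * g y)%:E) `^ p <=
   (A `^ (p - 1) * B)%:E * \int[mu]_y (g y `^ p)%:E)%E.
Proof.
have mkf (f : T -> R) : measurable_fun [set: T] f ->
    measurable_fun [set: T * T] (fun z => (k z.1 z.2 * f z.2)%:E).
  move=> mf; apply/measurable_EFinP/measurable_funM => //.
  exact: (measurableT_comp mf measurable_snd).
have kf0 (f : T -> R) : (forall x, 0 <= f x) ->
    forall z : T * T, (0 <= (k z.1 z.2 * f z.2)%:E)%E.
  by move=> f0 z; rewrite lee_fin mulr_ge0.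
have mI (f : T -> R) : measurable_fun [set: T] f -> (forall x, 0 <= f x) ->
    measurable_fun [set: T] (fun x => \int[mu]_y (k x y * f y)%:E)%E.
  move=> mf f0.
  exact: (measurable_fun_fubini_tonelli_F _ (mkf f mf) (kf0 f f0)).
apply: (@le_trans _ _ (\int[mu]_x
    (\int[mu]_y (k x y * h y)%:E * ((A * phi x) `^ (p - 1))%:E))%E).
  apply: ge0_le_integral => //.
  - by move=> x _; exact: poweR_ge0.
  - exact: (measurableT_comp (measurable_poweR _) (mI g mg g0)).
  - apply: emeasurable_funM; first exact: mI.
    by apply/measurable_EFinP; apply: mpow; exact: measurable_funM.
  - by move=> x _; exact: schur_pointwise.
pose w x := (A * phi x) `^ (p - 1).
have mw : measurable_fun [set: T] w by apply: mpow; exact: measurable_funM.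
have w0 x : 0 <= w x by exact: powR_ge0.
pose f2 (z : T * T) := (k z.1 z.2 * h z.2 * w z.1)%:E.
have mf2 : measurable_fun [set: T * T] f2.
  apply/measurable_EFinP/measurable_funM; first by have /measurable_EFinP := mkf h mh.
  exact: (measurableT_comp mw measurable_fst).
have f20 z : (0 <= f2 z)%E by rewrite lee_fin !mulr_ge0 ?powR_ge0.
rewrite (_ : (\int[mu]_x _)%E = (\int[mu]_x \int[mu]_y f2 (x, y))%E); last first.
  apply: eq_integral => x _; rewrite -ge0_integralZr//.
  - by apply/measurable_EFinP/measurable_funM.
  - by move=> y _; rewrite lee_fin mulr_ge0 ?powR_ge0.
  - by rewrite lee_fin powR_ge0.
have -> := fubini_tonelli _ mf2 f20.
rewrite -ge0_integralZl_EFin//; last 3 first.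
- by move=> y _; rewrite lee_fin powR_ge0.
- by apply/measurable_EFinP/mpow.
- by rewrite mulr_ge0 ?powR_ge0.
apply: ge0_le_integral => //.
- by move=> y _; apply: integral_ge0.
- exact: (measurable_fun_fubini_tonelli_G _ mf2 f20).
- by apply: measurable_funeM; apply/measurable_EFinP/mpow.
move=> y _; rewrite /f2 /=.
rewrite (@eq_integral _ _ _ mu setT (fun x =>
    ((h y * A `^ (p - 1))%:E * (k x y * phi x `^ (p - 1))%:E)%E)); last first.
  by move=> x _; rewrite -EFinM; congr EFin; rewrite /w powRM//; ring.
rewrite ge0_integralZl_EFin//; last 3 first.
- by move=> x _; rewrite lee_fin mulr_ge0 ?powR_ge0.
- apply/measurable_EFinP/measurable_funM; last exact: mpow.
  exact: measurable_fun_pair1 mk.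
- by rewrite mulr_ge0 ?powR_ge0.
apply: (@le_trans _ _ ((h y * A `^ (p - 1))%:E * (B * phi y `^ (p - 1))%:E)%E).
  by rewrite lee_wpmul2l// lee_fin mulr_ge0 ?powR_ge0.
rewrite -!EFinM lee_fin.
rewrite (_ : _ * (_ * _) = A `^ (p - 1) * B * (h y * phi y `^ (p - 1))); last by ring.
rewrite ler_wpM2l ?mulr_ge0 ?powR_ge0// /h -mulrA -[leRHS]mulr1.
rewrite ler_wpM2l ?powR_ge0//.
(* Where [phi] vanishes the two powers multiply to 0 instead of 1, which the inequality allows. *)
have [->|ph] := eqVneq (phi y) 0; first by rewrite [X in _ * X]powR0 ?mulr0// gt_eqF.
by rewrite -powRD ?ph ?implybT// addrA subrK subrr powRr0.
Qed.

End schur.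

(** * Integration over the plane and the Stein-Weiss kernel *)

Lemma plane_diskE (R : realType) (z : plane R) :
  plane_disk z <-> z.1 ^+ 2 + z.2 ^+ 2 < 1.
Proof.
rewrite /plane_disk /disk /= /cabs /= -{1}(@sqrtr1 R).
by split; rewrite ltr_sqrt ?ltr01.
Qed.

Lemma measurable_fst_snd (R : realType) :
  measurable_fun [set: plane R] (fun z => z.1 : R) /\
  measurable_fun [set: plane R] (fun z => z.2 : R).
Proof. by split; [exact: measurable_fst|exact: measurable_snd]. Qed.

Lemma measurable_plane_disk (R : realType) : measurable (@plane_disk R).
Proof.
rewrite (_ : @plane_disk R = [set z | z.1 ^+ 2 + z.2 ^+ 2 < 1]); last first.
  by apply/seteqP; split => z /plane_diskE.
have [m1 m2] := measurable_fst_snd R.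
have mq : measurable_fun [set: plane R] (fun z => z.1 ^+ 2 + z.2 ^+ 2 : R).
  by apply: measurable_funD; exact: measurable_funX.
have := mq measurableT _ (measurable_itv `]-oo, (1 : R)[).
by rewrite setTI set_itvNyo.
Qed.

(** The exhaustion is taken increasing so that its squares cover the plane: a point belongs to the
    square of the larger of its two indices. *)
Lemma area_sigma_finite (R : realType) : sigma_finite setT (area R).
Proof.
have /sigma_finiteP[F [TF ndF oF]] := sigma_finiteT (@lebesgue_measure R).
exists (fun n => F n `*` F n).
  rewrite -setXTT TF; apply/seteqP; split => -[x y] /=.
    move=> [[n _ Fnx] [k _ Fky]]; exists (maxn n k) => //; split.
      by move: x Fnx; apply/subsetPset/ndF/leq_maxl.
    by move: y Fky; apply/subsetPset/ndF/leq_maxr.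
  by move=> [n _ []/= ? ?]; split; exists n.
move=> n; have [mF Fy] := oF n; split; first exact: measurableX.
have -> : area R (F n `*` F n) = (lebesgue_measure (F n) * lebesgue_measure (F n))%E.
  exact: product_measure1E.
by rewrite lte_mul_pinfty// ge0_fin_numE.
Qed.

(* Canonical inference does not find this structure on a product measure. *)
Definition sigma_finite_area (R : realType) : {sigma_finite_measure set (plane R) -> \bar R} :=
  HB.pack (Measure.sort (area R)) (Measure_isSigmaFinite.Build _ _ _ (area R) (@area_sigma_finite R)).

Lemma integral_area_mul (R : realType) (f g : R -> R) :
  measurable_fun [set: measurableTypeR R] f ->
  measurable_fun [set: measurableTypeR R] g ->
  (forall x, 0 <= f x) -> (forall x, 0 <= g x) ->
  (\int[area R]_z (f z.1 * g z.2)%:E =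
   \int[@lebesgue_measure R]_x (f x)%:E * \int[@lebesgue_measure R]_x (g x)%:E)%E.
Proof.
move=> mf mg f0 g0; have [m1 m2] := measurable_fst_snd R.
have i0 : (0 <= \int[@lebesgue_measure R]_x (g x)%:E)%E.
  by apply: integral_ge0 => x _; rewrite lee_fin.
rewrite /area fubini_tonelli1; last 2 first.
- apply/measurable_EFinP/measurable_funM.
    exact: (measurableT_comp mf m1).
  exact: (measurableT_comp mg m2).
- by move=> z; rewrite lee_fin mulr_ge0.
rewrite -ge0_integralZr//; last 2 first.
- exact/measurable_EFinP.
- by move=> x _; rewrite lee_fin.
apply: eq_integral => x _ /=; rewrite /fubini_F /=.
under eq_integral do rewrite EFinM.
rewrite ge0_integralZl_EFin//.
- by move=> y _; rewrite lee_fin.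
- exact/measurable_EFinP.
Qed.

(** The bound on the inner integral is invariant under translation, so [g] may be centred on any
    measurable graph [c]. The graphs will be arcs of the unit circle, over either axis. *)
Lemma integral_area_slice_le (R : realType) (f g : R -> R) (c : R -> R) (A B : R) :
  measurable_fun [set: measurableTypeR R] f ->
  measurable_fun [set: measurableTypeR R] g ->
  measurable_fun [set: measurableTypeR R] c ->
  (forall x, 0 <= f x) -> (forall x, 0 <= g x) -> 0 <= B ->
  (\int[@lebesgue_measure R]_x (f x)%:E <= A%:E)%E ->
  (forall a, \int[@lebesgue_measure R]_x (g (x - a))%:E <= B%:E)%E ->
  (\int[area R]_z (f z.1 * g (z.2 - c z.1))%:E <= (A * B)%:E)%E /\
  (\int[area R]_z (f z.2 * g (z.1 - c z.2))%:E <= (A * B)%:E)%E.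
Proof.
move=> mf mg mc f0 g0 B0 fA gB; have [m1 m2] := measurable_fst_snd R.
have mgc a : measurable_fun [set: measurableTypeR R] (fun x => g (x - a)).
  by apply: (measurableT_comp mg); exact: measurable_funB.
have main : (\int[@lebesgue_measure R]_x
    \int[@lebesgue_measure R]_y (f x * g (y - c x))%:E <= (A * B)%:E)%E.
  apply: (@le_trans _ _ (\int[@lebesgue_measure R]_x ((f x)%:E * B%:E))%E).
    apply: ge0_le_integral => //.
    - by move=> x _; apply: integral_ge0 => y _; rewrite lee_fin mulr_ge0.
    - apply: (measurable_fun_fubini_tonelli_F (m2 := @lebesgue_measure R)
        (fun z : plane R => (f z.1 * g (z.2 - c z.1))%:E)).
        apply/measurable_EFinP/measurable_funM; first exact: (measurableT_comp mf m1).
        apply: (measurableT_comp mg); apply: measurable_funB => //.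
        exact: (measurableT_comp mc m1).
      by move=> z; rewrite lee_fin mulr_ge0.
    - by apply: emeasurable_funM => //; exact/measurable_EFinP.
    move=> x _; under eq_integral do rewrite EFinM.
    rewrite ge0_integralZl_EFin//; last 2 first.
    - by move=> y _; rewrite lee_fin.
    - exact/measurable_EFinP.
    by rewrite lee_wpmul2l// lee_fin.
  rewrite ge0_integralZr//; last 2 first.
  - exact/measurable_EFinP.
  - by move=> x _; rewrite lee_fin.
  by rewrite EFinM lee_wpmul2r.
split; rewrite /area.
  rewrite fubini_tonelli1//.
    apply/measurable_EFinP/measurable_funM; first exact: (measurableT_comp mf m1).
    apply: (measurableT_comp mg); apply: measurable_funB => //.
    exact: (measurableT_comp mc m1).
  by move=> z; rewrite lee_fin mulr_ge0.
rewrite fubini_tonelli2//.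
  apply/measurable_EFinP/measurable_funM; first exact: (measurableT_comp mf m2).
  apply: (measurableT_comp mg); apply: measurable_funB => //.
  exact: (measurableT_comp mc m2).
by move=> z; rewrite lee_fin mulr_ge0.
Qed.

Definition hardy_kernel (R : realType) (b a x y : R) : R :=
  (x != a)%:R * (`|y - x| `^ (b - 1) * `|y - a| `^ (- b)).

Lemma hardy_kernel_ge0 (R : realType) (b a x y : R) : 0 <= hardy_kernel b a x y.
Proof. by rewrite !mulr_ge0 ?powR_ge0 ?ler0n. Qed.

Lemma measurable_hardy_kernel d (T : measurableType d) (R : realType) (b a : R)
    (f g : T -> measurableTypeR R) :
  measurable_fun [set: T] f -> measurable_fun [set: T] g ->
  measurable_fun [set: T] (fun z => hardy_kernel b a (f z) (g z)).
Proof.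
move=> mf mg.
have mpow (h : T -> measurableTypeR R) c : measurable_fun [set: T] h ->
    measurable_fun [set: T] (fun z => `|h z| `^ c).
  move=> mh; apply: (measurableT_comp (measurable_powR c)).
  exact: (measurableT_comp (@normr_measurable R setT) mh).
apply: measurable_funM; last first.
  by apply: measurable_funM; apply: mpow; exact: measurable_funB.
rewrite (_ : (fun z => _) = \1_(~` [set a]) \o f); last first.
  apply/funext => z /=; rewrite indicE.
  by have [->|/eqP fa] := eqVneq (f z) a; [rewrite memNset// => /(_ erefl)|rewrite mem_set].
by apply: (measurableT_comp _ mf); apply: measurable_indic; exact: measurableC.
Qed.

(** With [b = 1/p], the integrands have singular exponents [1 - b, 2 b] and [1 - b, 1 - b]. In each
    pair both are below 1 and the sum exceeds 1, since [0 < b < 1/2]. *)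
Lemma hardy_kernel_schur (R : realType) (p : R) : 2 < p ->
  exists C : R, 0 <= C /\ forall a,
  (forall x, \int[@lebesgue_measure R]_y
     (hardy_kernel p^-1 a x y * `|y - a| `^ (- p^-1))%:E
     <= (C * `|x - a| `^ (- p^-1))%:E)%E /\
  (forall y, \int[@lebesgue_measure R]_x
     (hardy_kernel p^-1 a x y * (`|x - a| `^ (- p^-1)) `^ (p - 1))%:E
     <= (C * (`|y - a| `^ (- p^-1)) `^ (p - 1))%:E)%E.
Proof.
move=> p2; set b := p^-1.
have b0 : 0 < b by rewrite invr_gt0; lra.
have b1 : b < 2^-1 by rewrite ltf_pV2// posrE; lra.
have bp : - b * (p - 1) = b - 1 by rewrite /b; field; rewrite gt_eqF//; lra.
have [C [C0 HC]] : exists C : R, 0 <= C /\ forall x a : R, x != a ->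
    (\int[@lebesgue_measure R]_t (`|t - x| `^ (- (1 - b)) * `|t - a| `^ (- (2 * b)))%:E
     <= (C * `|x - a| `^ (1 - (1 - b) - 2 * b))%:E)%E.
  by apply: integral_powR_powR_le; lra.
have [D [D0 HD]] : exists C : R, 0 <= C /\ forall x a : R, x != a ->
    (\int[@lebesgue_measure R]_t (`|t - x| `^ (- (1 - b)) * `|t - a| `^ (- (1 - b)))%:E
     <= (C * `|x - a| `^ (1 - (1 - b) - (1 - b)))%:E)%E.
  by apply: integral_powR_powR_le; lra.
exists (C + D); split; first exact: addr_ge0.
move=> a; split => [x|y].
  have [->|xa] := eqVneq x a.
    rewrite /hardy_kernel eqxx integral0_eq => [|y _]; last by rewrite !mul0r.
    by rewrite lee_fin mulr_ge0 ?addr_ge0 ?powR_ge0.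
  rewrite (@eq_integral _ (measurableTypeR R) R (@lebesgue_measure R) setT
    (fun t : R => (`|t - x| `^ (- (1 - b)) * `|t - a| `^ (- (2 * b)))%:E)); last first.
    move=> t _; rewrite /hardy_kernel xa mul1r -mulrA -powRD ?opprB.
      by rewrite (_ : - b - b = - (2 * b))//; ring.
    by rewrite lt_eqF//; lra.
  apply: le_trans (HC _ _ xa) _; rewrite lee_fin.
  rewrite (_ : 1 - (1 - b) - 2 * b = - b); last by ring.
  by rewrite ler_wpM2r ?powR_ge0// lerDl.
rewrite -powRrM bp.
(* At [y = a] the kernel vanishes by the convention on powers of 0. *)
have [->|ya] := eqVneq y a.
  rewrite /hardy_kernel integral0_eq => [|x _].
    by rewrite lee_fin mulr_ge0 ?addr_ge0 ?powR_ge0.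
  by rewrite subrr normr0 [X in _ * (_ * X)]powR0 ?mulr0 ?mul0r// oppr_eq0 gt_eqF.
apply: (@le_trans _ _ (\int[@lebesgue_measure R]_t ((`|y - a| `^ (- b))%:E *
    (`|t - y| `^ (- (1 - b)) * `|t - a| `^ (- (1 - b)))%:E)%E)%E).
  apply: ge0_le_integral => //.
  - by move=> x _; rewrite lee_fin mulr_ge0 ?hardy_kernel_ge0 ?powR_ge0.
  - apply/measurable_EFinP/measurable_funM; last first.
      exact: (measurableT_comp (measurable_powR _) (measurable_powR_normB _ _)).
    by apply: measurable_hardy_kernel => //; exact: measurable_cst.
  - apply: measurable_funeM; apply/measurable_EFinP/measurable_funM;
      exact: measurable_powR_normB.
  move=> x _; rewrite -EFinM lee_fin /hardy_kernel opprB (distrC y x) -powRrM bp.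
  rewrite [leRHS](_ : _ = 1 * (`|x - y| `^ (b - 1) * `|y - a| `^ (- b)) *
    `|x - a| `^ (b - 1)); last by ring.
  by rewrite ler_wpM2r ?powR_ge0// ler_wpM2r ?mulr_ge0 ?powR_ge0// lern1 leq_b1.
rewrite ge0_integralZl_EFin ?powR_ge0//; last first.
  by apply/measurable_EFinP/measurable_funM; exact: measurable_powR_normB.
apply: (@le_trans _ _ ((`|y - a| `^ (- b))%:E *
  (D * `|y - a| `^ (1 - (1 - b) - (1 - b)))%:E)%E).
  by rewrite lee_wpmul2l ?HD// lee_fin powR_ge0.
rewrite -EFinM lee_fin mulrCA -powRD; last first.
  by rewrite normr_eq0 subr_eq0 ya implybT.
rewrite (_ : - b + _ = b - 1); last by ring.
by rewrite ler_wpM2r ?powR_ge0// lerDr.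
Qed.

(** Kernel and test function are both tensor products, so each Schur integral factors and the
    one-dimensional constants multiply. *)
Lemma hardy_inequality (R : realType) (p : R) : 2 < p ->
  exists C : R, 0 <= C /\ forall (a : plane R) (g : plane R -> R),
    measurable_fun [set: plane R] g -> (forall z, 0 <= g z) ->
  (\int[area R]_x (\int[area R]_y
      (hardy_kernel p^-1 a.1 x.1 y.1 * hardy_kernel p^-1 a.2 x.2 y.2 * g y)%:E) `^ p
   <= C%:E * \int[area R]_y (g y `^ p)%:E)%E.
Proof.
move=> p2; have [C [C0 HC]] := hardy_kernel_schur p2.
have p0 : 0 < p by lra.
exists ((C * C) `^ (p - 1) * (C * C)); split; first by rewrite mulr_ge0 ?powR_ge0 ?mulr_ge0.
move=> a g mg g0; have [m1 m2] := measurable_fst_snd R.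
pose phi (y : plane R) := `|y.1 - a.1| `^ (- p^-1) * `|y.2 - a.2| `^ (- p^-1).
have mhk c x : measurable_fun [set: measurableTypeR R] (fun y => hardy_kernel p^-1 c x y).
  by apply: measurable_hardy_kernel => //; exact: measurable_cst.
have mhk' c y : measurable_fun [set: measurableTypeR R] (fun x => hardy_kernel p^-1 c x y).
  by apply: measurable_hardy_kernel => //; exact: measurable_cst.
have hp0 c x y : 0 <= hardy_kernel p^-1 c x y by exact: hardy_kernel_ge0.
apply: (@schur_test _ _ R (sigma_finite_area R) p (C * C) (C * C)
  (fun x y : plane R =>
     hardy_kernel p^-1 a.1 x.1 y.1 * hardy_kernel p^-1 a.2 x.2 y.2) phi g) => //.
- by lra.
- by rewrite mulr_ge0.
- by rewrite mulr_ge0.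
- apply: measurable_funM; apply: measurable_hardy_kernel.
  + exact: (measurableT_comp m1 measurable_fst).
  + exact: (measurableT_comp m1 measurable_snd).
  + exact: (measurableT_comp m2 measurable_fst).
  + exact: (measurableT_comp m2 measurable_snd).
- apply: measurable_funM.
    exact: (measurableT_comp (measurable_powR_normB _ _) m1).
  exact: (measurableT_comp (measurable_powR_normB _ _) m2).
- by move=> x y; rewrite mulr_ge0.
- by move=> x; rewrite mulr_ge0 ?powR_ge0.
(* The test function can vanish only through its factors at [a], and these also occur in the
   kernel. *)
- move=> x y; rewrite /hardy_kernel !mulf_eq0 !negb_or => /andP[].
  move=> /andP[_ /andP[_ y1]] /andP[_ /andP[_ y2]].
  by rewrite mulr_gt0// lt_def ?y1 ?y2 powR_ge0.
- move=> x.
  rewrite (_ : (\int[_]_y _)%E = (\int[area R]_y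
    (hardy_kernel p^-1 a.1 x.1 y.1 * `|y.1 - a.1| `^ (- p^-1) *
    (hardy_kernel p^-1 a.2 x.2 y.2 * `|y.2 - a.2| `^ (- p^-1)))%:E)%E); last first.
    by apply: eq_integral => y _; congr EFin; rewrite mulrACA.
  rewrite (@integral_area_mul _
    (fun t => hardy_kernel p^-1 a.1 x.1 t * `|t - a.1| `^ (- p^-1))
    (fun t => hardy_kernel p^-1 a.2 x.2 t * `|t - a.2| `^ (- p^-1))); last 4 first.
  + by apply: measurable_funM => //; exact: measurable_powR_normB.
  + by apply: measurable_funM => //; exact: measurable_powR_normB.
  + by move=> t; rewrite mulr_ge0 ?powR_ge0.
  + by move=> t; rewrite mulr_ge0 ?powR_ge0.
  rewrite /phi mulrACA EFinM; apply: lee_pmul.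
  + by apply: integral_ge0 => t _; rewrite lee_fin mulr_ge0 ?powR_ge0.
  + by apply: integral_ge0 => t _; rewrite lee_fin mulr_ge0 ?powR_ge0.
  + exact: (HC a.1).1.
  + exact: (HC a.2).1.
- move=> y.
  rewrite (_ : (\int[_]_x _)%E = (\int[area R]_x
    (hardy_kernel p^-1 a.1 x.1 y.1 * (`|x.1 - a.1| `^ (- p^-1)) `^ (p - 1) *
    (hardy_kernel p^-1 a.2 x.2 y.2 * (`|x.2 - a.2| `^ (- p^-1)) `^ (p - 1)))%:E)%E); last first.
    by apply: eq_integral => x _; congr EFin; rewrite powRM ?powR_ge0// mulrACA.
  have mpp c : measurable_fun [set: measurableTypeR R]
      (fun t : R => (`|t - c| `^ (- p^-1)) `^ (p - 1)).
    exact: (measurableT_comp (measurable_powR _) (measurable_powR_normB _ _)).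
  rewrite (@integral_area_mul _
    (fun t => hardy_kernel p^-1 a.1 t y.1 * (`|t - a.1| `^ (- p^-1)) `^ (p - 1))
    (fun t => hardy_kernel p^-1 a.2 t y.2 * (`|t - a.2| `^ (- p^-1)) `^ (p - 1)));
    last 4 first.
  + exact: measurable_funM.
  + exact: measurable_funM.
  + by move=> t; rewrite mulr_ge0 ?powR_ge0.
  + by move=> t; rewrite mulr_ge0 ?powR_ge0.
  rewrite /phi powRM ?powR_ge0// mulrACA EFinM; apply: lee_pmul.
  + by apply: integral_ge0 => t _; rewrite lee_fin mulr_ge0 ?powR_ge0.
  + by apply: integral_ge0 => t _; rewrite lee_fin mulr_ge0 ?powR_ge0.
  + exact: (HC a.1).2.
  + exact: (HC a.2).2.
Qed.

(** * The Bergman kernel *)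

Definition defect (R : realType) (z : plane R) : R := 1 - z.1 ^+ 2 - z.2 ^+ 2.

(* [|1 - w * eta^*| ^ 2] in real coordinates. *)
Definition bergman_sq (R : realType) (w z : plane R) : R :=
  (1 - w.1 * z.1 - w.2 * z.2) ^+ 2 + (w.2 * z.1 - w.1 * z.2) ^+ 2.

Lemma plane_disk_defect (R : realType) (z : plane R) : plane_disk z <-> 0 < defect z.
Proof. by rewrite plane_diskE /defect; split; lra. Qed.

Lemma bergman_sqC (R : realType) (w z : plane R) : bergman_sq w z = bergman_sq z w.
Proof. by rewrite /bergman_sq; ring. Qed.

(** The classical identity behind [|w - z| <= |1 - w conj z|] on the disk. *)
Lemma bergman_sq_dist (R : realType) (w z : plane R) :
  bergman_sq w z = (w.1 - z.1) ^+ 2 + (w.2 - z.2) ^+ 2 + defect w * defect z.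
Proof. by rewrite /bergman_sq /defect; ring. Qed.

(** The real part of [1 - w conj z] is half of [defect w + defect z + |w - z|^2]. *)
Lemma bergman_sq_ge_defect (R : realType) (w z : plane R) :
  0 < defect w -> 0 < defect z -> ((defect w + defect z) / 2) ^+ 2 <= bergman_sq w z.
Proof.
move=> w0 z0; rewrite /bergman_sq -[leLHS]addr0 lerD ?sqr_ge0//.
rewrite ler_sqr ?nnegrE; [|lra|]; rewrite /defect in w0 z0 *.
  suff : 0 <= (w.1 - z.1) ^+ 2 + (w.2 - z.2) ^+ 2 by nra.
  by rewrite addr_ge0 ?sqr_ge0.
suff : 0 <= (w.1 - z.1) ^+ 2 + (w.2 - z.2) ^+ 2 by nra.
by rewrite addr_ge0 ?sqr_ge0.
Qed.

(** [q] stands for [|1 - w conj z|^2], [r] and [e] for the two defects, [v] for the difference along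
    one axis and [t] for the signed distance to the circle along the other. Splitting [1/q] into the
    powers [1 + s/2] and [1 - s/2] of [1/sqrt q] gives each variable a total exponent [1 + s/2 > 1],
    as the second one also receives the [s] of [e ^ (- s)]. *)
Lemma bergman_sq_riesz (R : realType) (s q r e v t : R) :
  0 < s -> s < 1 -> 0 < r -> 0 < e -> 0 < `|t| -> `|t| <= 2 * e ->
  v ^+ 2 <= q -> ((r + e) / 2) ^+ 2 <= q ->
  q `^ (- 1) * e `^ (- s) <=
  32 * (riesz 0 (1 + s / 2) r v * riesz s (1 - s / 2) r t).
Proof.
move=> s0 s1 r0 e0 t0 te vq req.
have q0 : 0 < q by apply: lt_le_trans req; rewrite exprn_gt0//; lra.
have u0 : 0 < Num.sqrt q by rewrite sqrtr_gt0.
have uv : `|v| <= Num.sqrt q by rewrite -sqrtr_sqr ler_wsqrtr.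
have ure : (r + e) / 2 <= Num.sqrt q.
  by rewrite -ler_sqr ?nnegrE ?sqrtr_ge0 ?sqr_sqrtr ?(ltW q0)// divr_ge0 ?addr_ge0 ?ltW.
have -> : q `^ (- 1) = Num.sqrt q `^ (- (1 + s / 2)) * Num.sqrt q `^ (- (1 - s / 2)).
  rewrite -powRD ?(gt_eqF u0) ?implybT//.
  rewrite -powR12_sqrt ?(ltW q0)// -powRrM; congr (_ `^ _); by field.
have sc (x c : R) : 0 <= x -> (4^-1 * x) `^ (- c) = 4 `^ c * x `^ (- c).
  move=> x0; rewrite powRM ?invr_ge0//; congr (_ * _).
  by rewrite -powR_inv1// -powRrM mulN1r opprK.
have sc2 (x c : R) : 0 <= x -> (2^-1 * x) `^ (- c) = 2 `^ c * x `^ (- c).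
  move=> x0; rewrite powRM ?invr_ge0//; congr (_ * _).
  by rewrite -powR_inv1// -powRrM mulN1r opprK.
have b1 : Num.sqrt q `^ (- (1 + s / 2)) <= 4 `^ (1 + s / 2) * (r + `|v|) `^ (- (1 + s / 2)).
  rewrite -sc ?addr_ge0 ?(ltW r0)//; apply: powRN_le; last lra.
    by rewrite mulr_gt0 ?invr_gt0// ltr_wpDr.
  lra.
have b2 : Num.sqrt q `^ (- (1 - s / 2)) <= 4 `^ (1 - s / 2) * (r + `|t|) `^ (- (1 - s / 2)).
  rewrite -sc ?addr_ge0 ?(ltW r0)//; apply: powRN_le; last lra.
    by rewrite mulr_gt0 ?invr_gt0// ltr_wpDr.
  lra.
have b3 : e `^ (- s) <= 2 `^ s * `|t| `^ (- s).
  by rewrite -sc2//; apply: powRN_le; lra.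
(* The origin of 32: it is [4 ^ 2 * 2], with [2 ^ s <= 2]. *)
have b4 : 4 `^ (1 + s / 2) * 4 `^ (1 - s / 2) * 2 `^ s <= 32 :> R.
  rewrite -powRD ?pnatr_eq0 ?implybT// (_ : 1 + s / 2 + (1 - s / 2) = 2%:R); last by field.
  rewrite powR_mulrn//.
  have : (2 : R) `^ s <= 2 `^ 1 by rewrite ler_powR ?ler1n// ltW.
  by rewrite powRr1//; lra.
apply: (@le_trans _ _ ((4 `^ (1 + s / 2) * (r + `|v|) `^ (- (1 + s / 2))) *
  (4 `^ (1 - s / 2) * (r + `|t|) `^ (- (1 - s / 2))) * (2 `^ s * `|t| `^ (- s)))).
  by rewrite ler_pM ?mulr_ge0 ?powR_ge0// ler_pM ?powR_ge0.
rewrite /riesz oppr0 powRr0 mul1r.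
rewrite [leLHS](_ : _ = (4 `^ (1 + s / 2) * 4 `^ (1 - s / 2) * 2 `^ s) *
  ((r + `|v|) `^ (- (1 + s / 2)) * (`|t| `^ (- s) * (r + `|t|) `^ (- (1 - s / 2)))));
  last by ring.
by rewrite ler_wpM2r// !mulr_ge0 ?powR_ge0.
Qed.

(** With [Y] the height of the circle over [x], the defect factors as [(Y - |y|) (Y + |y|)]. The
    condition [x ^ 2 <= y ^ 2] keeps the point away from the vertical tangents, so that
    [Y >= 1/2]. *)
Lemma dist_to_circle (R : realType) (x y : R) :
  x ^+ 2 <= y ^+ 2 -> x ^+ 2 + y ^+ 2 < 1 ->
  0 < Num.sqrt (1 - x ^+ 2) - `|y| <= 2 * (1 - x ^+ 2 - y ^+ 2).
Proof.
move=> xy xy1; set Y := Num.sqrt _.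
have YY : Y ^+ 2 = 1 - x ^+ 2 by rewrite sqr_sqrtr//; nra.
have Y0 : 0 <= Y by exact: sqrtr_ge0.
have y0 : 0 <= `|y| by [].
have yy : `|y| ^+ 2 = y ^+ 2 by rewrite real_normK ?num_real.
rewrite -yy in xy xy1 *; move: (`|y|) y0 xy xy1 => {yy}y y0 xy xy1.
have Yy : y < Y by rewrite -ltr_sqr ?nnegrE//; lra.
rewrite subr_gt0 Yy -YY /=.
have Y2 : 2^-1 <= Y by rewrite -ler_sqr ?nnegrE//; nra.
nra.
Qed.

Lemma integralD_le d (T : measurableType d) (R : realType)
    (mu : {measure set T -> \bar R}) (f g : T -> \bar R) (a b : R) :
  measurable_fun [set: T] f -> measurable_fun [set: T] g ->
  (forall x, 0 <= f x)%E -> (forall x, 0 <= g x)%E ->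
  (\int[mu]_x f x <= a%:E)%E -> (\int[mu]_x g x <= b%:E)%E ->
  (\int[mu]_x (f x + g x) <= (a + b)%:E)%E.
Proof. by move=> mf mg f0 g0 fa gb; rewrite ge0_integralD// EFinD leeD. Qed.

Lemma measurable_bergman_sq d (T : measurableType d) (R : realType)
    (f g : T -> plane R) :
  measurable_fun [set: T] f -> measurable_fun [set: T] g ->
  measurable_fun [set: T] (fun z => bergman_sq (f z) (g z)).
Proof.
move=> mf mg; have [m1 m2] := measurable_fst_snd R.
have f1 := measurableT_comp m1 mf; have f2 := measurableT_comp m2 mf.
have g1 := measurableT_comp m1 mg; have g2 := measurableT_comp m2 mg.
apply: measurable_funD; apply: measurable_funX; apply: measurable_funB.
- by apply: measurable_funB => //; exact: measurable_funM.
- exact: measurable_funM.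
- exact: measurable_funM.
- exact: measurable_funM.
Qed.

Lemma measurable_defect (R : realType) :
  measurable_fun [set: plane R] (@defect R).
Proof.
have [m1 m2] := measurable_fst_snd R.
by apply: measurable_funB; [apply: measurable_funB => //|]; exact: measurable_funX.
Qed.

Lemma measurable_sqrt_compl (R : realType) :
  measurable_fun [set: measurableTypeR R] (fun t : R => Num.sqrt (1 - t ^+ 2)).
Proof.
apply: (@measurableT_comp _ _ _ _ _ _ (@Num.sqrt R)).
  by apply: continuous_measurable_fun; exact: sqrt_continuous.
by apply: measurable_funB => //; exact: measurable_funX.
Qed.

(** This is [pi] times the modulus of the Bergman kernel, extended by zero so that Schur's test can
    be run on the whole plane. *)
Definition disk_kernel (R : realType) (w z : plane R) : R :=
  \1_(@plane_disk R) w * \1_(@plane_disk R) z * bergman_sq w z `^ (- 1).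

Lemma disk_kernel_ge0 (R : realType) (w z : plane R) : 0 <= disk_kernel w z.
Proof. by rewrite !mulr_ge0 ?powR_ge0. Qed.

Lemma disk_kernelC (R : realType) (w z : plane R) : disk_kernel w z = disk_kernel z w.
Proof. by rewrite /disk_kernel bergman_sqC [X in X * _]mulrC. Qed.

Lemma disk_kernel_outl (R : realType) (w z : plane R) :
  ~ plane_disk w -> disk_kernel w z = 0.
Proof. by move=> wD; rewrite /disk_kernel indicE memNset// !mul0r. Qed.

Lemma disk_kernel_outr (R : realType) (w z : plane R) :
  ~ plane_disk z -> disk_kernel w z = 0.
Proof. by rewrite disk_kernelC; exact: disk_kernel_outl. Qed.

Lemma disk_kernel_in (R : realType) (w z : plane R) :
  plane_disk w -> plane_disk z -> disk_kernel w z = (bergman_sq w z)^-1.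
Proof.
move=> wD zD; rewrite /disk_kernel !indicE !mem_set// !mul1r powR_inv1//.
by rewrite addr_ge0 ?sqr_ge0.
Qed.

Lemma measurable_disk_kernel d (T : measurableType d) (R : realType)
    (f g : T -> plane R) :
  measurable_fun [set: T] f -> measurable_fun [set: T] g ->
  measurable_fun [set: T] (fun z => disk_kernel (f z) (g z)).
Proof.
move=> mf mg; have m1D : measurable_fun [set: plane R] (\1_(@plane_disk R) : plane R -> R).
  by apply: measurable_indic; exact: measurable_plane_disk.
apply: measurable_funM.
  by apply: measurable_funM; [exact: (measurableT_comp m1D mf)|exact: (measurableT_comp m1D mg)].
exact: (measurableT_comp (measurable_powR _) (measurable_bergman_sq mf mg)).
Qed.

(* Near the boundary the disk is a subgraph, over the [x]-axis where *)
(* [|x| <= |y|] and over the [y]-axis where [|y| <= |x|]. *)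
Lemma bergman_sq_slices (R : realType) (s : R) (w z : plane R)
    (F := riesz 0 (1 + s / 2) (defect w)) (G := riesz s (1 - s / 2) (defect w))
    (Y := fun t : R => Num.sqrt (1 - t ^+ 2)) :
  0 < s -> s < 1 -> plane_disk w -> plane_disk z ->
  bergman_sq w z `^ (- 1) * defect z `^ (- s) <=
  32 * ((F (z.1 - w.1) * G (z.2 - Y z.1) + F (z.1 - w.1) * G (z.2 - (- Y z.1))) +
        (F (z.2 - w.2) * G (z.1 - Y z.2) + F (z.2 - w.2) * G (z.1 - (- Y z.2)))).
Proof.
move=> s0 s1 wD zD.
have w0 : 0 < defect w by exact/plane_disk_defect.
have z0 : 0 < defect z by exact/plane_disk_defect.
have FG0 a b : 0 <= F a * G b by rewrite mulr_ge0 ?riesz_ge0.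
have dq := bergman_sq_ge_defect w0 z0.
have vq1 : (z.1 - w.1) ^+ 2 <= bergman_sq w z.
  rewrite bergman_sq_dist -(sqrrN (_ - _)) opprB -addrA lerDl.
  by rewrite addr_ge0 ?sqr_ge0 ?mulr_ge0 ?ltW.
have vq2 : (z.2 - w.2) ^+ 2 <= bergman_sq w z.
  rewrite bergman_sq_dist -(sqrrN (_ - _)) opprB addrAC lerDr.
  by rewrite addr_ge0 ?sqr_ge0 ?mulr_ge0 ?ltW.
have half x y v : x ^+ 2 <= y ^+ 2 -> defect z = 1 - x ^+ 2 - y ^+ 2 ->
    v ^+ 2 <= bergman_sq w z ->
    bergman_sq w z `^ (- 1) * defect z `^ (- s) <=
    32 * (F v * G (y - Y x) + F v * G (y - (- Y x))).
  move=> xy dE vq; rewrite dE in z0 dq *.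
  have /andP[t0 t1] : 0 < Y x - `|y| <= 2 * (1 - x ^+ 2 - y ^+ 2).
    by apply: dist_to_circle => //; lra.
  (* The sign of [y] selects the nearer arc; the term of the other arc is dropped. *)
  have [y0|y0] := leP 0 y.
    rewrite ger0_norm// in t0 t1.
    have tE : `|y - Y x| = Y x - y by rewrite distrC gtr0_norm.
    apply: (@le_trans _ _ (32 * (F v * G (y - Y x)))); last by rewrite mulrDr lerDl mulr_ge0.
    by apply: bergman_sq_riesz vq dq => //; rewrite tE.
  rewrite ltr0_norm// in t0 t1.
  have tE : `|y - - Y x| = Y x - - y by rewrite gtr0_norm; lra.
  apply: (@le_trans _ _ (32 * (F v * G (y - - Y x)))); last by rewrite mulrDr lerDr mulr_ge0.
  by apply: bergman_sq_riesz vq dq => //; rewrite tE.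
rewrite mulrDr; have [xy|/ltW yx] := leP (z.1 ^+ 2) (z.2 ^+ 2).
  by apply: le_trans (half _ _ _ xy _ vq1) _ => //; rewrite lerDl mulr_ge0 ?addr_ge0.
apply: le_trans (half _ _ _ yx _ vq2) _; last by rewrite lerDr mulr_ge0 ?addr_ge0.
by rewrite /defect addrAC.
Qed.

(** Each slice is a product of two one-dimensional integrals, and each of these contributes
    [defect w ^ (- s / 2)]. *)
Lemma forelli_rudin (R : realType) (s : R) : 0 < s -> s < 1 ->
  exists C : R, 0 <= C /\ forall w : plane R,
  (\int[area R]_z (disk_kernel w z * defect z `^ (- s))%:E
     <= (C * defect w `^ (- s))%:E)%E.
Proof.
move=> s0 s1.
have [C1 [C10 H1]] : exists C : R, 0 <= C /\ forall r c : R, 0 < r ->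
    (\int[@lebesgue_measure R]_t (riesz 0 (1 + s / 2) r (t - c))%:E
     <= (C * r `^ (1 - 0 - (1 + s / 2)))%:E)%E by apply: integral_riesz_le; lra.
have [C2 [C20 H2]] : exists C : R, 0 <= C /\ forall r c : R, 0 < r ->
    (\int[@lebesgue_measure R]_t (riesz s (1 - s / 2) r (t - c))%:E
     <= (C * r `^ (1 - s - (1 - s / 2)))%:E)%E by apply: integral_riesz_le; lra.
(* 32 from the pointwise bound, times the four arcs. *)
exists (128 * (C1 * C2)); split; first by rewrite !mulr_ge0.
move=> w; have [wD|wD] := pselect (plane_disk w); last first.
  rewrite integral0_eq => [|z _]; first by rewrite lee_fin !mulr_ge0 ?powR_ge0.
  by rewrite disk_kernel_outl// mul0r.
have w0 : 0 < defect w by exact/plane_disk_defect.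
pose F t := riesz 0 (1 + s / 2) (defect w) t.
pose G t := riesz s (1 - s / 2) (defect w) t.
pose Y t := Num.sqrt (1 - t ^+ 2) : R.
have [m1 m2] := measurable_fst_snd R.
have mF : measurable_fun [set: measurableTypeR R] F by exact: measurable_riesz.
have mG : measurable_fun [set: measurableTypeR R] G by exact: measurable_riesz.
have mY : measurable_fun [set: measurableTypeR R] Y by exact: measurable_sqrt_compl.
have mNY : measurable_fun [set: measurableTypeR R] (fun t => - Y t).
  exact: (measurableT_comp _ mY).
have mFc c : measurable_fun [set: measurableTypeR R] (fun t => F (t - c)).
  by apply: (measurableT_comp mF); exact: measurable_funB.
pose A := C1 * defect w `^ (1 - 0 - (1 + s / 2)).
pose B := C2 * defect w `^ (1 - s - (1 - s / 2)).
have B0 : 0 <= B by rewrite mulr_ge0 ?powR_ge0.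
have sl (c : R -> R) d : measurable_fun [set: measurableTypeR R] c ->
  (\int[area R]_z (F (z.1 - d) * G (z.2 - c z.1))%:E <= (A * B)%:E)%E /\
  (\int[area R]_z (F (z.2 - d) * G (z.1 - c z.2))%:E <= (A * B)%:E)%E.
  move=> mc; apply: (@integral_area_slice_le _ (fun t => F (t - d)) G c A B) => //.
  - by move=> t; exact: riesz_ge0.
  - by move=> t; exact: riesz_ge0.
  - exact: H1.
  - by move=> a; exact: H2.
have mS1 (c : R -> R) d : measurable_fun [set: measurableTypeR R] c ->
  measurable_fun [set: plane R] (fun z => (F (z.1 - d) * G (z.2 - c z.1))%:E).
  move=> mc; apply/measurable_EFinP/measurable_funM; first exact: (measurableT_comp (mFc d) m1).
  by apply: (measurableT_comp mG); apply: measurable_funB => //; exact: (measurableT_comp mc m1).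
have mS2 (c : R -> R) d : measurable_fun [set: measurableTypeR R] c ->
  measurable_fun [set: plane R] (fun z => (F (z.2 - d) * G (z.1 - c z.2))%:E).
  move=> mc; apply/measurable_EFinP/measurable_funM; first exact: (measurableT_comp (mFc d) m2).
  by apply: (measurableT_comp mG); apply: measurable_funB => //; exact: (measurableT_comp mc m2).
have FG0 a b : (0 <= (F a * G b)%:E)%E by rewrite lee_fin mulr_ge0 ?riesz_ge0.
pose S (z : plane R) := (((F (z.1 - w.1) * G (z.2 - Y z.1))%:E +
    (F (z.1 - w.1) * G (z.2 - (- Y z.1)))%:E) +
   ((F (z.2 - w.2) * G (z.1 - Y z.2))%:E +
    (F (z.2 - w.2) * G (z.1 - (- Y z.2)))%:E))%E.
have mS : measurable_fun [set: plane R] S.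
  apply: emeasurable_funD; apply: emeasurable_funD.
  - exact: (mS1 Y).
  - exact: (mS1 (fun t => - Y t)).
  - exact: (mS2 Y).
  - exact: (mS2 (fun t => - Y t)).
have S0 z : (0 <= S z)%E by rewrite !adde_ge0.
apply: (@le_trans _ _ (\int[area R]_z (32%:E * S z))%E).
  apply: ge0_le_integral => //.
  - by move=> z _; rewrite lee_fin mulr_ge0 ?disk_kernel_ge0 ?powR_ge0.
  - apply/measurable_EFinP/measurable_funM.
      by apply: measurable_disk_kernel => //; exact: measurable_cst.
    exact: (measurableT_comp (measurable_powR _) (@measurable_defect R)).
  - exact: measurable_funeM.
  - move=> z _; have [zD|zD] := pselect (plane_disk z); last first.
      by rewrite disk_kernel_outr// mul0r mule_ge0.
    rewrite /disk_kernel !indicE !mem_set// !mul1r /S -!EFinD -EFinM lee_fin.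
    exact: bergman_sq_slices.
rewrite ge0_integralZl_EFin//.
apply: (@le_trans _ _ (32%:E * (((A * B) + (A * B)) + ((A * B) + (A * B)))%:E)%E).
  rewrite lee_wpmul2l//.
  apply: integralD_le => //.
  - by apply: emeasurable_funD; [exact: (mS1 Y)|exact: (mS1 (fun t => - Y t))].
  - by apply: emeasurable_funD; [exact: (mS2 Y)|exact: (mS2 (fun t => - Y t))].
  - by move=> z; rewrite adde_ge0.
  - by move=> z; rewrite adde_ge0.
  - apply: integralD_le => //; first exact: (mS1 Y).
    + exact: (mS1 (fun t => - Y t)).
    + exact: (sl Y _ mY).1.
    + exact: (sl (fun t => - Y t) _ mNY).1.
  - apply: integralD_le => //; first exact: (mS2 Y).
    + exact: (mS2 (fun t => - Y t)).
    + exact: (sl Y _ mY).2.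
    + exact: (sl (fun t => - Y t) _ mNY).2.
have -> : defect w `^ (- s) =
    defect w `^ (1 - 0 - (1 + s / 2)) * defect w `^ (1 - s - (1 - s / 2)).
  rewrite -powRD ?(gt_eqF w0) ?implybT//; congr (_ `^ _); by field.
by rewrite -EFinM lee_fin eqW// /A /B; ring.
Qed.

(** The test function [defect ^ (- 1/p)] has [(p - 1)]-st power [defect ^ (- (1 - 1/p))]. Both
    exponents lie in the Forelli-Rudin range, and the symmetry of the kernel turns the second Schur
    condition into an integral of the same form. *)
Lemma bergman_schur (R : realType) (p : R) : 2 < p ->
  exists C : R, 0 <= C /\ forall g : plane R -> R,
    measurable_fun [set: plane R] g -> (forall z, 0 <= g z) ->
  (\int[area R]_x (\int[area R]_y (disk_kernel x y * g y)%:E) `^ p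
   <= C%:E * \int[area R]_y (g y `^ p)%:E)%E.
Proof.
move=> p2; have p0 : 0 < p by lra.
have b0 : 0 < p^-1 by rewrite invr_gt0.
have b1 : p^-1 < 2^-1 by rewrite ltf_pV2// posrE; lra.
have bp : - p^-1 * (p - 1) = - (1 - p^-1) by field; rewrite gt_eqF.
have [A [A0 HA]] : exists C : R, 0 <= C /\ forall w : plane R,
  (\int[area R]_z (disk_kernel w z * defect z `^ (- p^-1))%:E
     <= (C * defect w `^ (- p^-1))%:E)%E by apply: forelli_rudin; lra.
have [B [B0 HB]] : exists C : R, 0 <= C /\ forall w : plane R,
  (\int[area R]_z (disk_kernel w z * defect z `^ (- (1 - p^-1)))%:E
     <= (C * defect w `^ (- (1 - p^-1)))%:E)%E by apply: forelli_rudin; lra.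
exists (A `^ (p - 1) * B); split; first by rewrite mulr_ge0 ?powR_ge0.
move=> g mg g0.
apply: (@schur_test _ _ R (sigma_finite_area R) p A B (@disk_kernel R)
  (fun z => defect z `^ (- p^-1)) g) => //.
- by lra.
- by apply: measurable_disk_kernel; [exact: measurable_fst|exact: measurable_snd].
- exact: (measurableT_comp (measurable_powR _) (@measurable_defect R)).
- exact: disk_kernel_ge0.
- by move=> x; exact: powR_ge0.
- move=> x y; have [yD _|yD] := pselect (plane_disk y).
    by apply: powR_gt0; exact/plane_disk_defect.
  by rewrite disk_kernel_outr// eqxx.
- move=> y; rewrite -powRrM bp.
  rewrite (_ : (\int[_]_x _)%E = (\int[area R]_z
    (disk_kernel y z * defect z `^ (- (1 - p^-1)))%:E)%E); first exact: HB.
  by apply: eq_integral => x _; rewrite disk_kernelC -powRrM bp.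
Qed.

(** The comparison of a planar distance with the product of its coordinates degenerates on the lines
    through [c] parallel to the axes; they are null. *)
Lemma ae_area_neq (R : realType) (c : plane R) :
  {ae area R, forall z, z.1 != c.1 /\ z.2 != c.2}.
Proof.
have mT : measurable [set: measurableTypeR R] by [].
have ms (t : R) : measurable ([set t] : set (measurableTypeR R)) by exact: measurable_set1.
have E (A B : set (measurableTypeR R)) : measurable A -> measurable B ->
    (lebesgue_measure A * lebesgue_measure B = 0)%E -> (area R).-negligible (A `*` B).
  move=> mA mB AB; exists (A `*` B); split => //; first exact: measurableX.
  by rewrite -AB; exact: product_measure1E.
apply: (@negligibleS _ _ _ (area R)) (negligibleU (E [set c.1] setT _ _ _) (E setT [set c.2] _ _ _)) => //.
- by move=> z /= /not_andP[] /negP; rewrite negbK => /eqP zc; [left|right]; split.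
- by rewrite lebesgue_measure_set1 mul0e.
- by rewrite lebesgue_measure_set1 mule0.
Qed.

(** * The weighted estimate *)

Definition dist2 (R : realType) (z a : plane R) : R :=
  (z.1 - a.1) ^+ 2 + (z.2 - a.2) ^+ 2.

Lemma dist2_ge0 (R : realType) (z a : plane R) : 0 <= dist2 z a.
Proof. by rewrite addr_ge0 ?sqr_ge0. Qed.

Lemma measurable_dist2 (R : realType) (a : plane R) :
  measurable_fun [set: plane R] (fun z => dist2 z a).
Proof.
have [m1 m2] := measurable_fst_snd R.
by apply: measurable_funD; apply: measurable_funX; exact: measurable_funB.
Qed.

Lemma dist2_powR_le (R : realType) (b : R) (x y a : plane R) :
  0 <= b -> b <= 2^-1 ->
  dist2 x a `^ b <= 2 * (dist2 x y `^ b + dist2 y a `^ b).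
Proof.
move=> b0 b1.
(* By the parallelogram law, the difference of the two sides is the square of
   [(x - y) - (y - a)]. *)
have tri : dist2 x a <= 2 * (dist2 x y + dist2 y a).
  rewrite /dist2 -subr_ge0 [leRHS](_ : _ = (x.1 - y.1 - (y.1 - a.1)) ^+ 2 +
    (x.2 - y.2 - (y.2 - a.2)) ^+ 2); last by ring.
  by rewrite addr_ge0 ?sqr_ge0.
have p4 : (4 : R) `^ b <= 2.
  apply: (@le_trans _ _ (4 `^ 2^-1)); first by rewrite ler_powR// ler1n.
  rewrite powR12_sqrt// (_ : 4 = 2 ^+ 2); last by ring.
  by rewrite sqrtr_sqr ger0_norm.
have main u v : 0 <= u -> u <= v -> dist2 x a <= 2 * (u + v) ->
    dist2 x a `^ b <= 2 * (u `^ b + v `^ b).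
  move=> u0 uv h; have v0 := le_trans u0 uv.
  apply: (@le_trans _ _ ((4 * v) `^ b)).
    by rewrite ge0_ler_powR ?nnegrE ?dist2_ge0 ?mulr_ge0//; lra.
  rewrite powRM// mulrDr -[leLHS]add0r lerD ?mulr_ge0 ?powR_ge0//.
  by rewrite ler_wpM2r ?powR_ge0.
have [uv|/ltW vu] := leP (dist2 x y) (dist2 y a).
  by apply: main => //; exact: dist2_ge0.
by rewrite [X in 2 * X]addrC; apply: main; rewrite ?dist2_ge0// addrC.
Qed.

Lemma dist2_powRN_le (R : realType) (b : R) (x y : plane R) :
  0 <= b -> x.1 != y.1 -> x.2 != y.2 ->
  dist2 x y `^ (- b) <= `|x.1 - y.1| `^ (- b) * `|x.2 - y.2| `^ (- b).
Proof.
move=> b0 xy1 xy2; rewrite -powRM//; apply: powRN_le => //.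
  by rewrite mulr_gt0// normr_gt0 subr_eq0.
rewrite /dist2 -[(x.1 - _) ^+ 2]real_normK ?num_real// -[(x.2 - _) ^+ 2]real_normK ?num_real//.
have := sqr_ge0 (`|x.1 - y.1| - `|x.2 - y.2|).
move: (normr_ge0 (x.1 - y.1)) (normr_ge0 (x.2 - y.2)); nra.
Qed.

Lemma weighted_kernel_split (R : realType) (b t : R) (x y a : plane R) :
  0 < b -> b < 2^-1 -> 0 <= t ->
  x.1 != a.1 -> x.2 != a.2 -> y.1 != a.1 -> y.2 != a.2 -> y.1 != x.1 -> y.2 != x.2 ->
  disk_kernel x y * t * dist2 x a `^ b <=
  2 * (disk_kernel x y * (t * dist2 y a `^ b) +
       hardy_kernel b a.1 x.1 y.1 * hardy_kernel b a.2 x.2 y.2 * (t * dist2 y a `^ b)).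
Proof.
move=> b0 b1 t0 xa1 xa2 ya1 ya2 yx1 yx2.
have H0 c u v : 0 <= hardy_kernel b c u v by exact: hardy_kernel_ge0.
have [xD|xD] := pselect (plane_disk x); last first.
  by rewrite disk_kernel_outl// !mul0r add0r !mulr_ge0 ?powR_ge0.
have [yD|yD] := pselect (plane_disk y); last first.
  by rewrite disk_kernel_outr// !mul0r add0r !mulr_ge0 ?powR_ge0.
have k0 := disk_kernel_ge0 x y.
apply: (@le_trans _ _ (disk_kernel x y * t * (2 * (dist2 x y `^ b + dist2 y a `^ b)))).
  by rewrite ler_wpM2l ?(mulr_ge0 k0 t0)// dist2_powR_le// ltW.
rewrite [leLHS](_ : _ = 2 * (disk_kernel x y * (t * dist2 y a `^ b) +
  t * (disk_kernel x y * dist2 x y `^ b))); last by ring.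
rewrite ler_wpM2l// lerD2l.
have d0 : 0 < dist2 x y.
  by rewrite /dist2 ltr_pwDl ?sqr_ge0// exprn_even_gt0//= subr_eq0 eq_sym.
have dq : dist2 x y <= bergman_sq x y.
  rewrite bergman_sq_dist lerDl mulr_ge0// ltW//; exact/plane_disk_defect.
(* The factor [|x - y|^(2 b)] softens the singularity of the kernel, which is at most
   [|x - y|^(-2)]. *)
have kd : disk_kernel x y * dist2 x y `^ b <= dist2 x y `^ (- (1 - b)).
  rewrite /disk_kernel !indicE !mem_set// !mul1r.
  apply: (@le_trans _ _ (dist2 x y `^ (- 1) * dist2 x y `^ b)).
    by rewrite ler_wpM2r ?powR_ge0// powRN_le.
  by rewrite -powRD ?(gt_eqF d0) ?implybT// opprB addrC.
have h1 : dist2 x y `^ (- (1 - b)) <=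
    `|y.1 - x.1| `^ (b - 1) * `|y.2 - x.2| `^ (b - 1).
  rewrite (distrC y.1 x.1) (distrC y.2 x.2) (_ : b - 1 = - (1 - b)); last by ring.
  by rewrite dist2_powRN_le 1?eq_sym//; lra.
(* The weight at [y] is absent from this term; it is restored at the price of its inverse, which
   becomes the factor at [a] of the tensor kernel. *)
have h2 : 1 <= `|y.1 - a.1| `^ (- b) * `|y.2 - a.2| `^ (- b) * dist2 y a `^ b.
  have e0 : 0 < dist2 y a.
    by rewrite /dist2 ltr_pwDl ?sqr_ge0// exprn_even_gt0//= subr_eq0.
  apply: (@le_trans _ _ (dist2 y a `^ (- b) * dist2 y a `^ b)).
    by rewrite -powRD ?(gt_eqF e0) ?implybT// addNr powRr0.
  by rewrite ler_wpM2r ?powR_ge0// dist2_powRN_le// ltW.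
rewrite /hardy_kernel xa1 xa2 !mul1r.
rewrite [leRHS](_ : _ = t * ((`|y.1 - x.1| `^ (b - 1) * `|y.2 - x.2| `^ (b - 1)) *
  (`|y.1 - a.1| `^ (- b) * `|y.2 - a.2| `^ (- b) * dist2 y a `^ b))); last by ring.
rewrite ler_wpM2l// -[leLHS]mulr1 ler_pM//.
  by rewrite mulr_ge0 ?powR_ge0.
exact: le_trans h1.
Qed.

(** If [x <= y] then [2 (x + y) <= 4 y]. This separates the contributions of the two kernels after
    taking [p]-th powers. *)
Lemma poweR_double_sum_le (R : realType) (p : R) (x y : \bar R) :
  0 <= p -> (0 <= x)%E -> (0 <= y)%E ->
  ((2%:E * (x + y)) `^ p <= (4 `^ p)%:E * (x `^ p + y `^ p))%E.
Proof.
move=> p0; wlog xy : x y / (x <= y)%E => [hw x0 y0|x0 y0].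
  have [xy|/ltW yx] := leP x y; first exact: hw.
  by rewrite addeC [(x `^ p + _)%E]addeC; exact: hw.
apply: (@le_trans _ _ ((4%:E * y) `^ p)%E).
  apply: gt0_ler_poweR; rewrite ?in_itv/= ?leey ?andbT//.
  - by rewrite mule_ge0// adde_ge0.
  - by rewrite mule_ge0.
  rewrite (_ : 4 = 2 * 2 :> R) ?EFinM -?muleA; last by ring.
  by rewrite lee_pmul2l//= [leRHS]mule_natl mule2n leeD2r.
rewrite poweRM// poweR_EFin lee_pmul2l ?lte_fin ?powR_gt0//.
by rewrite leeDr// poweR_ge0.
Qed.

Lemma weighted_bound (R : realType) (p : R) : 2 < p ->
  exists C : R, 0 <= C /\ forall (a : plane R) (F : plane R -> R),
    measurable_fun [set: plane R] F -> (forall z, 0 <= F z) ->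
  (\int[area R]_x ((\int[area R]_y (disk_kernel x y * F y)%:E) `^ p * (dist2 x a)%:E)
   <= C%:E * \int[area R]_y (F y `^ p * dist2 y a)%:E)%E.
Proof.
move=> p2; have p0 : 0 < p by lra.
have b0 : 0 < p^-1 by rewrite invr_gt0.
have b1 : p^-1 < 2^-1 by rewrite ltf_pV2// posrE; lra.
have [C1 [C10 H1]] := bergman_schur p2.
have [C2 [C20 H2]] := hardy_inequality p2.
exists (4 `^ p * (C1 + C2)); split; first by rewrite mulr_ge0 ?powR_ge0 ?addr_ge0.
move=> a F mF F0; have [m1 m2] := measurable_fst_snd R.
pose g z := F z * dist2 z a `^ p^-1.
have mg : measurable_fun [set: plane R] g.
  apply: measurable_funM => //.
  exact: (measurableT_comp (measurable_powR _) (measurable_dist2 a)).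
have g0 z : 0 <= g z by rewrite mulr_ge0 ?powR_ge0.
have gp z : g z `^ p = F z `^ p * dist2 z a.
  by rewrite powRM ?powR_ge0// -powRrM mulVf ?gt_eqF// powRr1// dist2_ge0.
pose K1 x y := @disk_kernel R x y.
pose K2 (x y : plane R) := hardy_kernel p^-1 a.1 x.1 y.1 * hardy_kernel p^-1 a.2 x.2 y.2.
have mK1 : measurable_fun [set: plane R * plane R] (fun z => K1 z.1 z.2).
  by apply: measurable_disk_kernel; [exact: measurable_fst|exact: measurable_snd].
have mK2 : measurable_fun [set: plane R * plane R] (fun z => K2 z.1 z.2).
  apply: measurable_funM; apply: measurable_hardy_kernel.
  + exact: (measurableT_comp m1 measurable_fst).
  + exact: (measurableT_comp m1 measurable_snd).
  + exact: (measurableT_comp m2 measurable_fst).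
  + exact: (measurableT_comp m2 measurable_snd).
have K10 x y : 0 <= K1 x y by exact: disk_kernel_ge0.
have K20 x y : 0 <= K2 x y by rewrite mulr_ge0 ?hardy_kernel_ge0.
pose I (K : plane R -> plane R -> R) (h : plane R -> R) x := (\int[area R]_y (K x y * h y)%:E)%E.
have mI (K : plane R -> plane R -> R) (h : plane R -> R) :
    measurable_fun [set: plane R * plane R] (fun z => K z.1 z.2) ->
    measurable_fun [set: plane R] h -> (forall x y, 0 <= K x y) -> (forall x, 0 <= h x) ->
    measurable_fun [set: plane R] (I K h).
  move=> mK mh K0 h0.
  apply: (measurable_fun_fubini_tonelli_F (m2 := sigma_finite_area R)
    (fun z : plane R * plane R => (K z.1 z.2 * h z.2)%:E)).
    by apply/measurable_EFinP/measurable_funM => //; exact: (measurableT_comp mh measurable_snd).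
  by move=> z; rewrite lee_fin mulr_ge0.
have I0 (K : plane R -> plane R -> R) (h : plane R -> R) x : (forall x y, 0 <= K x y) -> (forall x, 0 <= h x) -> (0 <= I K h x)%E.
  by move=> K0 h0; apply: integral_ge0 => y _; rewrite lee_fin mulr_ge0.
have mpow (f : plane R -> \bar R) : measurable_fun [set: plane R] f ->
    measurable_fun [set: plane R] (fun x => (f x `^ p)%E).
  by move=> mf; exact: (measurableT_comp (measurable_poweR _) mf).
have mKx (K : plane R -> plane R -> R) x :
    measurable_fun [set: plane R * plane R] (fun z => K z.1 z.2) ->
    measurable_fun [set: plane R] (K x).
  by move=> mK; exact: measurable_fun_pair2 mK.
apply: (@le_trans _ _ (\int[area R]_x ((4 `^ p)%:E * (I K1 g x `^ p + I K2 g x `^ p)))%E).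
  apply: ae_ge0_le_integral => //.
  - by move=> x _; rewrite mule_ge0 ?poweR_ge0// lee_fin dist2_ge0.
  - apply: emeasurable_funM; first by apply: mpow; exact: (mI K1 F).
    by apply/measurable_EFinP; exact: measurable_dist2.
  - by move=> x _; rewrite mule_ge0 ?adde_ge0 ?poweR_ge0// lee_fin powR_ge0.
  - apply: measurable_funeM; apply: emeasurable_funD; apply: mpow; exact: mI.
  (* On the lines through [a] the tensor kernel is zero by convention and dominates nothing. *)
  apply: filterS (ae_area_neq a) => x [xa1 xa2] _.
  have -> : (I K1 F x `^ p * (dist2 x a)%:E = (I K1 F x * (dist2 x a `^ p^-1)%:E) `^ p)%E.
    rewrite poweRM ?I0 ?lee_fin ?powR_ge0// poweR_EFin -powRrM mulVf ?gt_eqF//.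
    by rewrite powRr1// dist2_ge0.
  apply: le_trans (poweR_double_sum_le (ltW p0) (I0 K1 g x K10 g0) (I0 K2 g x K20 g0)).
  have mK1g : measurable_fun [set: plane R] (fun y => (K1 x y * g y)%:E).
    by apply/measurable_EFinP/measurable_funM => //; exact: mKx.
  have mK2g : measurable_fun [set: plane R] (fun y => (K2 x y * g y)%:E).
    by apply/measurable_EFinP/measurable_funM => //; exact: mKx.
  have K1g0 y : (0 <= (K1 x y * g y)%:E)%E by rewrite lee_fin mulr_ge0.
  have K2g0 y : (0 <= (K2 x y * g y)%:E)%E by rewrite lee_fin mulr_ge0.
  apply: gt0_ler_poweR; rewrite ?(ltW p0) ?in_itv/= ?leey ?andbT//.
  - by rewrite mule_ge0 ?I0// lee_fin powR_ge0.
  - by rewrite mule_ge0// adde_ge0// I0.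
  rewrite /I -ge0_integralZr//; last 3 first.
  - by apply/measurable_EFinP/measurable_funM => //; exact: mKx.
  - by move=> y _; rewrite lee_fin mulr_ge0.
  - by rewrite lee_fin powR_ge0.
  rewrite -ge0_integralD// -ge0_integralZl_EFin//; last 2 first.
  - by move=> y _; rewrite adde_ge0.
  - exact: emeasurable_funD.
  apply: ae_ge0_le_integral => //.
  - by move=> y _; rewrite mule_ge0 ?lee_fin ?mulr_ge0 ?powR_ge0.
  - apply: emeasurable_funM => //; apply/measurable_EFinP/measurable_funM => //.
    exact: mKx.
  - by move=> y _; rewrite mule_ge0// adde_ge0.
  - by apply: measurable_funeM; exact: emeasurable_funD.
  (* For fixed [x] the lines through [x] are discarded as well, since there the powers of
     [|y.1 - x.1|] or [|y.2 - x.2|] degenerate. *)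
  apply: filterS2 (ae_area_neq a) (ae_area_neq x) => y [ya1 ya2] [yx1 yx2] _.
  by rewrite -EFinD -!EFinM lee_fin; exact: weighted_kernel_split.
rewrite ge0_integralZl_EFin ?powR_ge0//; last 2 first.
- by move=> x _; rewrite adde_ge0 ?poweR_ge0.
- by apply: emeasurable_funD; apply: mpow; exact: mI.
rewrite EFinM -muleA lee_wpmul2l ?lee_fin ?powR_ge0//.
rewrite ge0_integralD//; last 4 first.
- by move=> x _; rewrite poweR_ge0.
- by apply: mpow; exact: mI.
- by move=> x _; rewrite poweR_ge0.
- by apply: mpow; exact: mI.
have <- : (\int[area R]_y (g y `^ p)%:E = \int[area R]_y (F y `^ p * dist2 y a)%:E)%E.
  by apply: eq_integral => y _; rewrite gp.
rewrite EFinD ge0_muleDl ?lee_fin//.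
by apply: leeD; [exact: H1|exact: H2].
Qed.

(** * Complex-valued functions *)

Local Open Scope complex_scope.

Lemma to_complexK (R : realType) (w : R[i]) :
  to_complex (complex.Re w, complex.Im w) = w.
Proof. by case: w. Qed.

Lemma sq_dist_weightE (R : realType) (a z : plane R) :
  sq_dist_weight (to_complex a) (to_complex z) = dist2 z a.
Proof.
by rewrite /sq_dist_weight /cabs /= sqr_sqrtr// addr_ge0 ?sqr_ge0.
Qed.

Lemma cabs_bergman_kernel (R : realType) (w z : plane R) :
  cabs (bergman_kernel (to_complex w) (to_complex z)) = (pi * bergman_sq w z)^-1.
Proof.
rewrite /bergman_kernel /cabs div1r ComplexField.Normc.normcV; congr (_^-1).
rewrite ComplexField.Normc.normcM expr2 ComplexField.Normc.normcM -expr2.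
rewrite sqr_sqrtr ?addr_ge0 ?sqr_ge0//; congr (_ * _).
  by rewrite /= expr0n addr0 sqrtr_sqr ger0_norm// pi_ge0.
by rewrite /bergman_sq /=; ring.
Qed.

Lemma cabs_ge0 (R : realType) (w : R[i]) : 0 <= cabs w.
Proof. by case: w => a b; exact: sqrtr_ge0. Qed.

Lemma normr_Re_le_cabs (R : realType) (w : R[i]) : `|complex.Re w| <= cabs w.
Proof. by case: w => a b; rewrite -sqrtr_sqr ler_wsqrtr// lerDl sqr_ge0. Qed.

Lemma normr_Im_le_cabs (R : realType) (w : R[i]) : `|complex.Im w| <= cabs w.
Proof. by case: w => a b; rewrite -sqrtr_sqr ler_wsqrtr// lerDr sqr_ge0. Qed.

Lemma cabs_le_normr (R : realType) (a b : R) : cabs (a +i* b) <= `|a| + `|b|.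
Proof.
rewrite /cabs /= -[leRHS]ger0_norm ?addr_ge0// -sqrtr_sqr ler_wsqrtr//.
rewrite sqrrD !real_normK ?num_real// addrAC lerDl.
by rewrite mulrn_wge0// mulr_ge0.
Qed.

Lemma Re_bergman_plus_integrand (R : realType) (f : R[i] -> R[i]) (w z : R[i]) :
  complex.Re (bergman_plus_integrand f w z) = cabs (bergman_kernel w z) * complex.Re (f z).
Proof. by rewrite /bergman_plus_integrand; case: (f z) => a b /=; rewrite mul0r subr0. Qed.

Lemma Im_bergman_plus_integrand (R : realType) (f : R[i] -> R[i]) (w z : R[i]) :
  complex.Im (bergman_plus_integrand f w z) = cabs (bergman_kernel w z) * complex.Im (f z).
Proof. by rewrite /bergman_plus_integrand; case: (f z) => a b /=; rewrite mul0r addr0. Qed.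

Definition real_integrand (R : realType) (h : plane R -> R) (w z : plane R) : R :=
  (pi * bergman_sq w z)^-1 * h z.

(** The modulus is cut off to the disk because the nonnegative estimates are stated on the whole
    plane. *)
Definition disk_abs (R : realType) (f : R[i] -> R[i]) (z : plane R) : R :=
  \1_(@plane_disk R) z * cabs (f (to_complex z)).

Lemma disk_abs_ge0 (R : realType) (f : R[i] -> R[i]) z : 0 <= disk_abs f z.
Proof. by rewrite mulr_ge0 ?cabs_ge0. Qed.

Lemma measurable_indicM d (T : measurableType d) (R : realType) (D : set T) (h : T -> R) :
  measurable D -> measurable_fun D h ->
  measurable_fun [set: T] (fun z => \1_D z * h z).
Proof.
move=> mD mh.
rewrite (_ : (fun z => _) = h \_ D); first exact/(measurable_restrictT _ mD).
apply/funext => z; rewrite patchE indicE; by case: ifP => _; rewrite ?mul1r ?mul0r.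
Qed.

Lemma integral_disk_indic (R : realType) (h : plane R -> \bar R) :
  (\int[area R]_(z in @plane_disk R) h z =
   \int[area R]_z ((\1_(@plane_disk R) z)%:E * h z))%E.
Proof.
rewrite integral_mkcond; apply: eq_integral => z _.
by rewrite patchE indicE; case: ifP => _; rewrite ?mul1e ?mul0e.
Qed.

Lemma measurable_disk_abs (R : realType) (f : R[i] -> R[i]) :
  disk_measurable f -> measurable_fun [set: plane R] (disk_abs f).
Proof.
move=> [mRe mIm]; apply: measurable_indicM; first exact: measurable_plane_disk.
rewrite (_ : (fun z : plane R => _) = (fun z => Num.sqrt (complex.Re (f (to_complex z)) ^+ 2 +
   complex.Im (f (to_complex z)) ^+ 2))); last first.
  by apply/funext => z; rewrite /cabs; case: (f _).
apply: (@measurableT_comp _ _ _ _ _ _ (@Num.sqrt R)).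
  by apply: continuous_measurable_fun; exact: sqrt_continuous.
by apply: measurable_funD; exact: measurable_funX.
Qed.

Definition Lp_mass (R : realType) (p : R) (a : plane R) (f : R[i] -> R[i]) : \bar R :=
  (\int[area R]_z (disk_abs f z `^ p * dist2 z a)%:E)%E.

Lemma Lp_normE (R : realType) (p : R) (a : plane R) (f : R[i] -> R[i]) : 0 < p ->
  Lp_norm p (sq_dist_weight (to_complex a)) f = (Lp_mass p a f `^ p^-1)%E.
Proof.
move=> p0; rewrite /Lp_norm integral_disk_indic; congr (_ `^ _)%E.
apply: eq_integral => z _; rewrite -EFinM sq_dist_weightE; congr EFin.
rewrite /disk_abs indicE; case: (z \in _) => /=; first by rewrite !mul1r.
by rewrite !mul0r powR0 ?gt_eqF// mul0r.
Qed.

Lemma Lp_mass_ge0 (R : realType) (p : R) (a : plane R) (f : R[i] -> R[i]) :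
  (0 <= Lp_mass p a f)%E.
Proof. by apply: integral_ge0 => z _; rewrite lee_fin mulr_ge0 ?powR_ge0 ?dist2_ge0. Qed.

Lemma bergman_sq_le4 (R : realType) (w z : plane R) :
  plane_disk w -> plane_disk z -> bergman_sq w z <= 4.
Proof.
move=> /plane_disk_defect wD /plane_disk_defect zD.
rewrite bergman_sq_dist /defect in wD zD *.
have := sqr_ge0 (w.1 + z.1); have := sqr_ge0 (w.2 + z.2).
have := sqr_ge0 (w.1); have := sqr_ge0 (w.2); have := sqr_ge0 (z.1); have := sqr_ge0 (z.2).
nra.
Qed.

Lemma area_disk_gt0 (R : realType) : area R (@plane_disk R) != 0%E.
Proof.
pose I : set (measurableTypeR R) := [set` `[0, 2^-1]].
have mI : measurable I by exact: measurable_itv.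
have II : area R (I `*` I) = (lebesgue_measure I * lebesgue_measure I)%E.
  exact: product_measure1E.
have lI : lebesgue_measure I = (2^-1)%:E.
  have := @lebesgue_measure_itv R `[0, 2^-1].
  by rewrite /= lte_fin invr_gt0 ltr0n -EFinB subr0.
apply: contraTneq isT => D0.
have : (area R (I `*` I) <= area R (@plane_disk R))%E.
  apply: le_measure; rewrite ?inE; [exact: measurableX|exact: measurable_plane_disk|].
  move=> z []; rewrite /I /= !in_itv/= => /andP[z1 z1'] /andP[z2 z2'].
  by apply/plane_diskE; nra.
by rewrite D0 II lI -EFinM lee_fin leNgt mulr_gt0// invr_gt0.
Qed.

Lemma disk_kernel_ge_quarter (R : realType) (f : R[i] -> R[i]) (w z : plane R) :
  plane_disk w -> 4^-1 * disk_abs f z <= disk_kernel w z * disk_abs f z.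
Proof.
move=> wD; have [zD|zD] := pselect (plane_disk z); last first.
  by rewrite /disk_abs indicE memNset// !mul0r !mulr0.
rewrite ler_wpM2r ?disk_abs_ge0// disk_kernel_in// lef_pV2 ?posrE//.
  exact: bergman_sq_le4.
have w0 : 0 < defect w by exact/plane_disk_defect.
have z0 : 0 < defect z by exact/plane_disk_defect.
by apply: lt_le_trans (bergman_sq_ge_defect w0 z0); rewrite exprn_gt0//; lra.
Qed.

(* The kernel is bounded below on the bidisk, so a function of infinite mass *)
(* would be sent to the constant [+oo]. *)
Lemma disk_abs_integral_lty (R : realType) (p : R) (a : plane R) (f : R[i] -> R[i]) :
  2 < p -> disk_measurable f -> (Lp_mass p a f < +oo)%E ->
  (\int[area R]_z (disk_abs f z)%:E < +oo)%E.
Proof.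
move=> p2 mf fp; have [C [C0 HC]] := weighted_bound p2.
have mF := measurable_disk_abs mf; have F0 := disk_abs_ge0 f.
rewrite ltNge leye_eq; apply/negP => /eqP Moo.
pose T x := (\int[area R]_y (disk_kernel x y * disk_abs f y)%:E)%E.
have T0 x : (0 <= T x)%E.
  by apply: integral_ge0 => y _; rewrite lee_fin mulr_ge0 ?disk_kernel_ge0.
have Too x : plane_disk x -> T x = +oo%E.
  move=> xD; apply/eqP; rewrite -leye_eq.
  have <- : (4^-1%:E * \int[area R]_z (disk_abs f z)%:E = +oo)%E.
    by rewrite Moo gt0_muley// lte_fin invr_gt0.
  rewrite -ge0_integralZl_EFin//; last 2 first.
  - by move=> y _; rewrite lee_fin.
  - exact/measurable_EFinP.
  apply: ge0_le_integral => //.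
  - by move=> y _; rewrite lee_fin mulr_ge0.
  - by apply: measurable_funeM; exact/measurable_EFinP.
  - apply/measurable_EFinP/measurable_funM => //.
    by apply: measurable_disk_kernel => //; exact: measurable_cst.
  - by move=> y _; rewrite -EFinM lee_fin disk_kernel_ge_quarter.
pose h x := (T x `^ p * (dist2 x a)%:E)%E.
have h0 x : (0 <= h x)%E by rewrite mule_ge0 ?poweR_ge0// lee_fin dist2_ge0.
have mT : measurable_fun [set: plane R] T.
  apply: (measurable_fun_fubini_tonelli_F (m2 := sigma_finite_area R)
    (fun z : plane R * plane R => (disk_kernel z.1 z.2 * disk_abs f z.2)%:E)).
    apply/measurable_EFinP/measurable_funM; last exact: (measurableT_comp mF measurable_snd).
    by apply: measurable_disk_kernel; [exact: measurable_fst|exact: measurable_snd].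
  by move=> z; rewrite lee_fin mulr_ge0 ?disk_kernel_ge0.
have mh : measurable_fun [set: plane R] h.
  apply: emeasurable_funM; first exact: (measurableT_comp (measurable_poweR _) mT).
  by apply/measurable_EFinP; exact: measurable_dist2.
have ih : (area R).-integrable setT h.
  apply/integrableP; split => //.
  under eq_integral do rewrite gee0_abs//.
  by apply: le_lt_trans (HC a _ mF F0) _; rewrite lte_mul_pinfty// Lp_mass_ge0.
suff D0 : area R (@plane_disk R) = 0%E by move: (area_disk_gt0 R); rewrite D0 eqxx.
apply: measure_negligible; first exact: measurable_plane_disk.
(* An integrable function is finite almost everywhere, while [h] is infinite at every point of the
   disk where [dist2 x a] is positive. Lines through [a] are excluded because [+oo * 0] is 0. *)
have : {ae area R, forall x, ~ plane_disk x}.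
  apply: filterS2 (ae_area_neq a) (integrable_ae measurableT ih) => x [xa _] hx xD.
  move: (hx I); rewrite /h Too// poweRyr; last by rewrite gt_eqF//; lra.
  rewrite gt0_mulye// lte_fin /dist2 ltr_pwDl ?sqr_ge0//.
  by rewrite exprn_even_gt0//= subr_eq0.
by apply: negligibleS => x xD /=; apply.
Qed.

(** * Integrability against the kernel, measurability of the image, linearity *)

Section integrands.
Context (R : realType) (f : R[i] -> R[i]) (h : plane R -> R).
Hypothesis mf : disk_measurable f.
Hypothesis mh : measurable_fun (@plane_disk R) h.
Hypothesis hf : forall z, `|h z| <= cabs (f (to_complex z)).
Hypothesis foo : (\int[area R]_z (disk_abs f z)%:E < +oo)%E.

Let mD := @measurable_plane_disk R.

Lemma measurable_real_integrand w :
  measurable_fun (@plane_disk R) (real_integrand h w).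
Proof.
apply: measurable_funM => //; apply: measurable_funTS.
rewrite (_ : (fun z => _) = (fun z => (pi * bergman_sq w z) `^ (- 1))); last first.
  apply/funext => z; rewrite powR_inv1//.
  by rewrite mulr_ge0 ?pi_ge0// addr_ge0 ?sqr_ge0.
apply: (measurableT_comp (measurable_powR _)); apply: measurable_funM => //.
by apply: measurable_bergman_sq => //; exact: measurable_cst.
Qed.

Let real_integrand_abs_le w z : plane_disk w -> plane_disk z ->
  `|real_integrand h w z| <= pi^-1 * (disk_kernel w z * disk_abs f z).
Proof.
move=> wD zD; rewrite /real_integrand normrM invfM disk_kernel_in//.
rewrite /disk_abs indicE mem_set// mul1r mulrA ler_pM// ger0_norm//.
by rewrite mulr_ge0 ?invr_ge0 ?pi_ge0// addr_ge0 ?sqr_ge0.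
Qed.

Let m_kf w : measurable_fun [set: plane R] (fun z => (disk_kernel w z * disk_abs f z)%:E).
Proof.
apply/measurable_EFinP/measurable_funM; last exact: measurable_disk_abs.
by apply: measurable_disk_kernel => //; exact: measurable_cst.
Qed.

Lemma integral_abs_real_integrand w : plane_disk w ->
  (\int[area R]_(z in @plane_disk R) `|(real_integrand h w z)%:E| <=
   pi^-1%:E * \int[area R]_z (disk_kernel w z * disk_abs f z)%:E)%E.
Proof.
move=> wD; have k0 z : 0 <= disk_kernel w z * disk_abs f z.
  by rewrite mulr_ge0 ?disk_kernel_ge0 ?disk_abs_ge0.
rewrite -ge0_integralZl_EFin ?invr_ge0 ?pi_ge0//; last by move=> z _; rewrite lee_fin.
apply: (@le_trans _ _ (\int[area R]_(z in @plane_disk R)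
    (pi^-1%:E * (disk_kernel w z * disk_abs f z)%:E))%E).
  apply: ge0_le_integral => //.
  - apply: (measurableT_comp (@abse_measurable _ setT)).
    by apply/measurable_EFinP; exact: measurable_real_integrand.
  - by apply: measurable_funTS; exact: measurable_funeM.
  - by move=> z zD; rewrite -EFinM lee_fin real_integrand_abs_le.
apply: ge0_subset_integral => //.
- exact: measurable_funeM.
- by move=> z _; rewrite -EFinM lee_fin mulr_ge0 ?invr_ge0 ?pi_ge0.
Qed.

(** For a fixed [w] in the disk the kernel is bounded in [z] by a constant depending on [defect w],
    so integrability of [|f|] suffices. *)
Lemma integrable_real_integrand w : plane_disk w ->
  (area R).-integrable (@plane_disk R) (fun z => (real_integrand h w z)%:E).
Proof.
move=> wD; apply/integrableP; split.
  by apply/measurable_EFinP; exact: measurable_real_integrand.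
apply: le_lt_trans (integral_abs_real_integrand wD) _.
have w0 : 0 < defect w by exact/plane_disk_defect.
apply: lte_mul_pinfty; rewrite ?lee_fin ?invr_ge0 ?pi_ge0//.
apply: (@le_lt_trans _ _ (\int[area R]_z
    ((((defect w / 2) ^+ 2)^-1)%:E * (disk_abs f z)%:E))%E).
  apply: ge0_le_integral => //.
  - by move=> z _; rewrite lee_fin mulr_ge0 ?disk_kernel_ge0 ?disk_abs_ge0.
  - by apply: measurable_funeM; apply/measurable_EFinP; exact: measurable_disk_abs.
  move=> z _; rewrite -EFinM lee_fin ler_wpM2r ?disk_abs_ge0//.
  have [zD|zD] := pselect (plane_disk z); last first.
    by rewrite disk_kernel_outr// invr_ge0 sqr_ge0.
  have z0 : 0 < defect z by exact/plane_disk_defect.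
  have d20 : 0 < (defect w / 2) ^+ 2 by rewrite exprn_gt0//; lra.
  have sqd : (defect w / 2) ^+ 2 <= bergman_sq w z.
    apply: le_trans (bergman_sq_ge_defect w0 z0); rewrite ler_sqr ?nnegrE; lra.
  by rewrite disk_kernel_in// lef_pV2 ?posrE//; exact: lt_le_trans sqd.
rewrite ge0_integralZl_EFin//; last 3 first.
- by move=> z _; rewrite lee_fin disk_abs_ge0.
- by apply/measurable_EFinP; exact: measurable_disk_abs.
- by rewrite invr_ge0 sqr_ge0.
by apply: lte_mul_pinfty; rewrite ?lee_fin ?invr_ge0 ?sqr_ge0.
Qed.

Lemma normr_Rintegral_real_integrand_le w : plane_disk w ->
  (`|\int[area R]_(z in @plane_disk R) real_integrand h w z|%:E <=
   pi^-1%:E * \int[area R]_z (disk_kernel w z * disk_abs f z)%:E)%E.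
Proof.
move=> wD; have iw := integrable_real_integrand wD.
apply: le_trans (integral_abs_real_integrand wD).
rewrite /Rintegral -abse_EFin fineK; last exact: integrable_fin_num.
by apply: le_abse_integral => //; exact: measurable_int iw.
Qed.

End integrands.

(** Tonelli gives measurability only for nonnegative integrands, hence the positive and negative
    parts; [fine] is measurable and absorbs infinite values. *)
Lemma measurable_fine_integral d1 d2 (T1 : measurableType d1) (T2 : measurableType d2)
    (R : realType) (mu : {sigma_finite_measure set T2 -> \bar R}) (k : T1 * T2 -> R) :
  measurable_fun [set: T1 * T2] k ->
  measurable_fun [set: T1] (fun x => fine (\int[mu]_y (k (x, y))%:E)%E).
Proof.
move=> mk; apply: (measurableT_comp (@fine_measurable _ setT measurableT)).
under eq_fun do rewrite integralE.
have mK : measurable_fun [set: T1 * T2] (EFin \o k) by exact/measurable_EFinP.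
apply: emeasurable_funB.
- rewrite (_ : (fun x => _) = fubini_F mu (EFin \o k)^\+%E); last first.
    by apply/funext => x; apply: eq_integral => y _; rewrite unlock.
  exact: measurable_fun_fubini_tonelli_F _ (measurable_funepos mK) (funepos_ge0 _).
- rewrite (_ : (fun x => _) = fubini_F mu (EFin \o k)^\-%E); last first.
    by apply/funext => x; apply: eq_integral => y _; rewrite unlock.
  exact: measurable_fun_fubini_tonelli_F _ (measurable_funeneg mK) (funeneg_ge0 _).
Qed.

Lemma measurable_Rintegral_real_integrand (R : realType) (h : plane R -> R) :
  measurable_fun (@plane_disk R) h ->
  measurable_fun (@plane_disk R)
    (fun w => \int[area R]_(z in @plane_disk R) real_integrand h w z).
Proof.
move=> mh; have mD := @measurable_plane_disk R.
pose k (z : plane R * plane R) :=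
  (pi * bergman_sq z.1 z.2) `^ (- 1) * (\1_(@plane_disk R) z.2 * h z.2).
have mk : measurable_fun [set: plane R * plane R] k.
  apply: measurable_funM.
    apply: (measurableT_comp (measurable_powR _)); apply: measurable_funM => //.
    by apply: measurable_bergman_sq; [exact: measurable_fst|exact: measurable_snd].
  exact: (measurableT_comp (measurable_indicM mD mh) measurable_snd).
apply: measurable_funTS.
rewrite (_ : (fun w => _) =
  (fun w => fine (\int[sigma_finite_area R]_z (k (w, z))%:E)%E)); last first.
  apply/funext => w; rewrite /Rintegral integral_disk_indic; congr fine.
  apply: eq_integral => z _; rewrite -EFinM /k /real_integrand /= powR_inv1.
    by rewrite mulrCA.
  by rewrite mulr_ge0 ?pi_ge0// addr_ge0 ?sqr_ge0.
exact: measurable_fine_integral.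
Qed.

Definition re_part (R : realType) (f : R[i] -> R[i]) (z : plane R) : R :=
  complex.Re (f (to_complex z)).

Definition im_part (R : realType) (f : R[i] -> R[i]) (z : plane R) : R :=
  complex.Im (f (to_complex z)).

Lemma bergman_plus_integrandE (R : realType) (f : R[i] -> R[i]) (w : plane R) :
  re_part (bergman_plus_integrand f (to_complex w)) = real_integrand (re_part f) w /\
  im_part (bergman_plus_integrand f (to_complex w)) = real_integrand (im_part f) w.
Proof.
split; apply/funext => z.
  by rewrite /re_part Re_bergman_plus_integrand cabs_bergman_kernel.
by rewrite /im_part Im_bergman_plus_integrand cabs_bergman_kernel.
Qed.

Lemma bergman_plusE (R : realType) (f : R[i] -> R[i]) (w : plane R) :
  bergman_plus f (to_complex w) =
    (\int[area R]_(z in @plane_disk R) real_integrand (re_part f) w z)%R +i*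
    (\int[area R]_(z in @plane_disk R) real_integrand (im_part f) w z)%R.
Proof. by have [<- <-] := bergman_plus_integrandE f w. Qed.

Lemma disk_measurable_bergman_plus (R : realType) (f : R[i] -> R[i]) :
  disk_measurable f -> disk_measurable (bergman_plus f).
Proof.
move=> [mRe mIm]; split.
- rewrite (_ : (fun z => _) = (fun w =>
    \int[area R]_(z in @plane_disk R) real_integrand (re_part f) w z)%R).
    exact: measurable_Rintegral_real_integrand.
  by apply/funext => w; rewrite bergman_plusE.
- rewrite (_ : (fun z => _) = (fun w =>
    \int[area R]_(z in @plane_disk R) real_integrand (im_part f) w z)%R).
    exact: measurable_Rintegral_real_integrand.
  by apply/funext => w; rewrite bergman_plusE.
Qed.

Lemma in_LpE (R : realType) (p : R) (a : plane R) (f : R[i] -> R[i]) : 0 < p ->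
  in_Lp p (sq_dist_weight (to_complex a)) f <->
  disk_measurable f /\ (Lp_mass p a f < +oo)%E.
Proof.
move=> p0; rewrite /in_Lp Lp_normE//; split=> -[mf fp]; split => //.
  by apply: lty_poweRy fp; rewrite invr_neq0// gt_eqF.
exact: poweR_lty.
Qed.

Section members.
Context (R : realType) (p : R) (p2 : 2 < p) (a : plane R).

Let inLp := in_Lp p (sq_dist_weight (to_complex a)).

Let p0 : 0 < p. Proof. exact: lt_trans p2. Qed.

Lemma in_Lp_integrable_re f w : inLp f -> plane_disk w ->
  (area R).-integrable (@plane_disk R) (EFin \o real_integrand (re_part f) w).
Proof.
move=> /(in_LpE _ _ p0)[mf fp] wD; apply: (integrable_real_integrand mf) => //.
- exact: mf.1.
- by move=> z; exact: normr_Re_le_cabs.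
- exact: disk_abs_integral_lty fp.
Qed.

Lemma in_Lp_integrable_im f w : inLp f -> plane_disk w ->
  (area R).-integrable (@plane_disk R) (EFin \o real_integrand (im_part f) w).
Proof.
move=> /(in_LpE _ _ p0)[mf fp] wD; apply: (integrable_real_integrand mf) => //.
- exact: mf.2.
- by move=> z; exact: normr_Im_le_cabs.
- exact: disk_abs_integral_lty fp.
Qed.

Lemma disk_integrable_bergman_plus f w : inLp f -> plane_disk w ->
  disk_integrable (bergman_plus_integrand f (to_complex w)).
Proof.
move=> fp wD; have [Ere Eim] := bergman_plus_integrandE f w; split.
  by have := in_Lp_integrable_re fp wD; rewrite -Ere.
by have := in_Lp_integrable_im fp wD; rewrite -Eim.
Qed.

(** The integral does not see null sets, so the two images agree at every point. *)
Lemma bergman_plus_ae f g : inLp f -> inLp g ->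
  disk_ae_eq f g -> disk_ae_eq (bergman_plus f) (bergman_plus g).
Proof.
move=> /(in_LpE _ _ p0)[mf _] /(in_LpE _ _ p0)[mg _] fg; apply: aeW => w _.
have mD := @measurable_plane_disk R.
rewrite !bergman_plusE /Rintegral; congr (fine _ +i* fine _); apply: ae_eq_integral => //.
- apply/measurable_EFinP; apply: measurable_real_integrand; exact: mf.1.
- apply/measurable_EFinP; apply: measurable_real_integrand; exact: mg.1.
- apply: filterS fg => z fg zD; congr EFin.
  by rewrite /real_integrand /re_part fg.
- apply/measurable_EFinP; apply: measurable_real_integrand; exact: mf.2.
- apply/measurable_EFinP; apply: measurable_real_integrand; exact: mg.2.
- apply: filterS fg => z fg zD; congr EFin.
  by rewrite /real_integrand /im_part fg.
Qed.

(** A complex scalar mixes the real and imaginary integrals; additivity holds at every point of the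
    disk because all four integrands are integrable there. *)
Lemma bergman_plus_linear c f g : inLp f -> inLp g ->
  disk_ae_eq (bergman_plus (fun w => c * f w + g w))
    (fun w => c * bergman_plus f w + bergman_plus g w).
Proof.
move=> fp gp; apply: aeW => w wD; have mD := @measurable_plane_disk R.
have fre := in_Lp_integrable_re fp wD; have fim := in_Lp_integrable_im fp wD.
have gre := in_Lp_integrable_re gp wD; have gim := in_Lp_integrable_im gp wD.
have iZ r (u : plane R -> R) : (area R).-integrable (@plane_disk R) (EFin \o u) ->
    (area R).-integrable (@plane_disk R) (EFin \o (fun z => r * u z)).
  move=> iu; rewrite (_ : _ \o _ = (fun z => r%:E * (EFin \o u) z)%E).
    exact: integrableZl.
  by apply/funext => z /=; rewrite EFinM.
have iD (u v : plane R -> R) : (area R).-integrable (@plane_disk R) (EFin \o u) ->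
    (area R).-integrable (@plane_disk R) (EFin \o v) ->
    (area R).-integrable (@plane_disk R) (EFin \o (fun z => u z + v z)).
  by move=> iu iv; exact: (integrableD mD iu iv).
case: c => c1 c2.
have E1 : real_integrand (re_part (fun w => (c1 +i* c2) * f w + g w)) w = (fun z =>
    (c1 * real_integrand (re_part f) w z + - c2 * real_integrand (im_part f) w z) +
    real_integrand (re_part g) w z).
  apply/funext => z; rewrite /real_integrand /re_part /im_part.
  by case: (f _) (g _) => f1 f2 [g1 g2] /=; ring.
have E2 : real_integrand (im_part (fun w => (c1 +i* c2) * f w + g w)) w = (fun z =>
    (c1 * real_integrand (im_part f) w z + c2 * real_integrand (re_part f) w z) +
    real_integrand (im_part g) w z).
  apply/funext => z; rewrite /real_integrand /re_part /im_part.
  by case: (f _) (g _) => f1 f2 [g1 g2] /=; ring.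
rewrite !bergman_plusE E1 E2.
rewrite !RintegralD ?RintegralZl//; try by [exact: iZ|apply: iD => //; exact: iZ].
by apply/eqP; rewrite eq_complex /= mulNr !eqxx.
Qed.

End members.

(** * Norm bounds uniform in the weight *)

Lemma bergman_plus_mass_le (R : realType) (p : R) : 2 < p ->
  exists C : R, 0 <= C /\ forall (a : plane R) (f : R[i] -> R[i]),
    in_Lp p (sq_dist_weight (to_complex a)) f ->
  (Lp_mass p a (bergman_plus f) <= C%:E * Lp_mass p a f)%E.
Proof.
move=> p2; have p0 : 0 < p by lra.
have [C [C0 HC]] := weighted_bound p2.
(* [1/pi] is the normalization of the Bergman kernel; 2 accounts for bounding real and imaginary
   parts separately. *)
exists ((2 * pi^-1) `^ p * C); split; first by rewrite mulr_ge0 ?powR_ge0.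
move=> a f /(in_LpE _ _ p0)[mf fp].
have mF := measurable_disk_abs mf; have F0 := disk_abs_ge0 f.
have foo := disk_abs_integral_lty p2 mf fp.
have c0 : 0 <= 2 * pi^-1 :> R by rewrite mulr_ge0 ?invr_ge0 ?pi_ge0.
pose T x := (\int[area R]_y (disk_kernel x y * disk_abs f y)%:E)%E.
have T0 x : (0 <= T x)%E.
  by apply: integral_ge0 => y _; rewrite lee_fin mulr_ge0 ?disk_kernel_ge0.
have mT : measurable_fun [set: plane R] T.
  apply: (measurable_fun_fubini_tonelli_F (m2 := sigma_finite_area R)
    (fun z : plane R * plane R => (disk_kernel z.1 z.2 * disk_abs f z.2)%:E)).
    apply/measurable_EFinP/measurable_funM; last exact: (measurableT_comp mF measurable_snd).
    by apply: measurable_disk_kernel; [exact: measurable_fst|exact: measurable_snd].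
  by move=> z; rewrite lee_fin mulr_ge0 ?disk_kernel_ge0.
have TfT w : ((disk_abs (bergman_plus f) w)%:E <= (2 * pi^-1)%:E * T w)%E.
  have [wD|wD] := pselect (plane_disk w); last first.
    by rewrite /disk_abs indicE memNset// mul0r mule_ge0.
  rewrite /disk_abs indicE mem_set// mul1r bergman_plusE.
  apply: le_trans (_ : (_ <= (`|\int[area R]_(z in @plane_disk R) real_integrand (re_part f) w z| +
    `|\int[area R]_(z in @plane_disk R) real_integrand (im_part f) w z|)%R%:E)%E) _.
    by rewrite lee_fin cabs_le_normr.
  rewrite EFinD EFinM -muleA mule_natl mule2n; apply: leeD.
    apply: (normr_Rintegral_real_integrand_le mf) => //; first exact: mf.1.
    by move=> z; exact: normr_Re_le_cabs.
  apply: (normr_Rintegral_real_integrand_le mf) => //; first exact: mf.2.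
  by move=> z; exact: normr_Im_le_cabs.
have mTp : measurable_fun [set: plane R] (fun x => T x `^ p * (dist2 x a)%:E)%E.
  apply: emeasurable_funM; first exact: (measurableT_comp (measurable_poweR _) mT).
  by apply/measurable_EFinP; exact: measurable_dist2.
have Tp0 x : (0 <= T x `^ p * (dist2 x a)%:E)%E.
  by rewrite mule_ge0 ?poweR_ge0// lee_fin dist2_ge0.
apply: (@le_trans _ _ (\int[area R]_x
    (((2 * pi^-1) `^ p)%:E * (T x `^ p * (dist2 x a)%:E)))%E).
  apply: ge0_le_integral => //.
  - by move=> x _; rewrite lee_fin mulr_ge0 ?powR_ge0 ?dist2_ge0.
  - apply/measurable_EFinP/measurable_funM; last exact: measurable_dist2.
    apply: (measurableT_comp (measurable_powR _)).
    by apply: measurable_disk_abs; exact: disk_measurable_bergman_plus.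
  - exact: measurable_funeM.
  move=> x _; rewrite EFinM muleA lee_wpmul2r ?lee_fin ?dist2_ge0//.
  rewrite -poweR_EFin -poweRM// -poweR_EFin.
  by apply: gt0_ler_poweR; rewrite ?(ltW p0) ?in_itv/= ?leey ?andbT ?lee_fin ?disk_abs_ge0 ?mule_ge0.
rewrite ge0_integralZl_EFin ?powR_ge0//.
rewrite EFinM -muleA lee_wpmul2l ?lee_fin ?powR_ge0//.
exact: HC.
Qed.

Lemma bergman_plus_norm_le (R : realType) (p : R) : 2 < p ->
  exists C : R, 0 <= C /\ forall (a : plane R) (f : R[i] -> R[i]),
    in_Lp p (sq_dist_weight (to_complex a)) f ->
  (Lp_norm p (sq_dist_weight (to_complex a)) (bergman_plus f) <=
   C%:E * Lp_norm p (sq_dist_weight (to_complex a)) f)%E.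
Proof.
move=> p2; have p0 : 0 < p by lra.
have [C [C0 HC]] := bergman_plus_mass_le p2.
exists (C `^ p^-1); split; first exact: powR_ge0.
move=> a f fp; rewrite !Lp_normE// -poweR_EFin -poweRM ?lee_fin ?Lp_mass_ge0//.
apply: gt0_ler_poweR; rewrite ?invr_ge0 ?(ltW p0) ?in_itv/= ?leey ?andbT ?Lp_mass_ge0//.
  by rewrite mule_ge0 ?Lp_mass_ge0.
exact: HC.
Qed.

Local Close Scope complex_scope.

Theorem proposition1p2 (R : realType) (p : R) (hp : 2 < p) :
  (forall w2 : R[i], disk w2 ->
     (forall f : R[i] -> R[i], in_Lp p (sq_dist_weight w2) f ->
        forall w : R[i], disk w ->
          disk_integrable (bergman_plus_integrand f w)) /\
     bounded_operator p (sq_dist_weight w2) (@bergman_plus R)) /\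
  (exists C : R, forall w2 : R[i], disk w2 ->
     (operator_norm p (sq_dist_weight w2) (@bergman_plus R) <= C%:E)%E).
Proof.
have p0 : 0 < p by lra.
have [C [C0 HC]] := bergman_plus_norm_le hp.
split => [w2 _|].
  rewrite -(to_complexK w2); set a := (_, _); split=> [f fp w wD|].
    rewrite -(to_complexK w); apply: (disk_integrable_bergman_plus hp fp).
    by rewrite /plane_disk /preimage/= to_complexK.
  split.
  - by move=> f g; exact: bergman_plus_ae.
  - by move=> c f g; exact: bergman_plus_linear.
  - move=> f fp; split; first by apply: disk_measurable_bergman_plus; exact: fp.1.
    apply: le_lt_trans (HC _ _ fp) _; apply: lte_mul_pinfty; rewrite ?lee_fin//.
    exact: fp.2.
  - by exists C => f; exact: HC.
(* [C] was obtained before [w2], so one constant bounds all the operator norms. *)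
exists C => w2 _; rewrite -(to_complexK w2); apply: ub_ereal_sup => _ [f [fp f1] <-].
apply: le_trans (HC _ _ fp) _; rewrite -[leRHS]mule1.
by rewrite lee_wpmul2l// lee_fin.
Qed.
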